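(* Let $\Gamma$ be a left-orderable virtually polycyclic group of exponential growth. Then $\mathcal{LO}(\Gamma)$ is homeomorphic to a Cantor set.
   Context: A left-ordering on a group $G$ is a total order $\preceq$ on $G$ such that $f\preceq g$ implies $hf\preceq hg$ for all $f,g,h\in G$; $G$ is left-orderable if it admits a left-ordering. The space $\mathcal{LO}(G)$ is the set of all left-orderings of $G$, with the topology having as a basis the sets $V_{f_1,\dots,f_k}=\{\preceq \;\mid\; id\preceq f_1,\dots, id\preceq f_k\}$, where $\{f_1,\dots,f_k\}$ runs over the finite subsets of $G$. A polycyclic group is a solvable group whose successive Abelian quotients in its derived series are finitely generated; a group is virtually polycyclic if it has a polycyclic subgroup of finite index. Exponential growth refers to the word growth with respect to a finite generating set. *)

(* Defs.v *)
From HB Require Import structures.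
From mathcomp Require Import all_boot all_order all_algebra finmap.
From mathcomp Require Import boolp classical_sets functions cardinality reals.
From mathcomp Require Import topology cantor.

Set Implicit Arguments.
Unset Strict Implicit.
Unset Printing Implicit Defensive.

Import Order.TTheory GRing.Theory Num.Theory.

Local Open Scope classical_set_scope.
Local Open Scope group_scope.

(** Subgroups of a (possibly infinite) group, as classical sets *)

Definition subgroup (G : groupType) (H : set G) : Prop :=
  [/\ H 1, forall x y, H x -> H y -> H (x * y) & forall x, H x -> H x^-1].

Definition generated (G : groupType) (S : set G) : set G :=
  smallest (@subgroup G) S.

Definition lcoset (G : groupType) (x : G) (N : set G) : set G :=
  [set x * y | y in N].

Definition lcosets (G : groupType) (H N : set G) : set (set G) :=
  [set lcoset x N | x in H].

(** [lcosets H N] is the underlying set of the quotient group [H / N] when [N]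
    is normal in [H]; the image of the subgroup generated by [S] under the
    projection [H -> H / N] is then the subgroup generated by the image of [S],
    so this says that [H / N] is generated by finitely many cosets. *)
Definition fg_quotient (G : groupType) (H N : set G) : Prop :=
  exists S : {fset G},
    [set` S] `<=` H /\ lcosets H N = lcosets (generated [set` S]) N.

Definition derived (G : groupType) (H : set G) : set G :=
  generated [set commg x y | x in H & y in H].

Definition derived_series (G : groupType) (H : set G) (n : nat) : set G :=
  iter n (@derived G) H.

Definition solvable (G : groupType) (H : set G) : Prop :=
  exists n, derived_series H n = [set 1].

Definition polycyclic (G : groupType) (H : set G) : Prop :=
  solvable H /\
  forall n, fg_quotient (derived_series H n) (derived_series H n.+1).

Definition virtually_polycyclic (G : groupType) : Prop :=
  exists H : set G,
    [/\ subgroup H, finite_set (lcosets [set: G] H) & polycyclic H].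

(** Word growth *)

Definition word_ball (G : groupType) (S : {fset G}) (n : nat) : set G :=
  [set \prod_(x <- w) x | w in
    [set w : seq G | (size w <= n)%N /\
                     forall x, x \in w -> x \in S \/ x^-1 \in S]].

Lemma word_ball_finite (G : groupType) (S : {fset G}) (n : nat) :
  finite_set (word_ball S n).
Proof.
pose T := (S `|` [fset x^-1 | x in S])%fset.
elim: n => [|n IHn].
  apply: (@sub_finite_set _ _ [set 1]); last exact: finite_set1.
  move=> _ [w [sw _] <-]; move: sw.
  by rewrite leqn0 => /eqP/size0nil->; rewrite big_nil.
apply: (@sub_finite_set _ _
  (word_ball S n `|` [set x * y | x in [set` T] & y in word_ball S n])).
  move=> y [w [sz lw] yE]; subst y.
  case: w sz lw => [|x w] sz lw; first by left; exists [::].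
  right; exists x; last first.
    exists (\prod_(z <- w) z); last by rewrite big_cons.
    by exists w => //; split=> // z zw; apply: lw; rewrite inE zw orbT.
  have /lw[xS|xS] : x \in x :: w by rewrite inE eqxx.
    by rewrite /= inE xS.
  rewrite /= inE; apply/orP; right; apply/imfsetP.
  by exists x^-1 => //; rewrite invgK.
rewrite finite_setU; split=> //.
by apply: finite_image2 => //; apply: finite_fset.
Qed.

(** [fset_set] is meaningful here by [word_ball_finite]. *)
Definition exponential_growth (R : realType) (G : groupType) : Prop :=
  exists2 S : {fset G}, generated [set` S] = [set: G] &
    exists2 c : R, (1 < c)%R &
      forall n, (c ^+ n <= #|` fset_set (word_ball S n)|%:R)%R.

(** The space of left-orderings *)

(** [total] includes reflexivity *)
Record left_ordering (G : groupType) := LeftOrdering {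
  lo_le :> rel G;
  lo_total : total lo_le;
  lo_anti : antisymmetric lo_le;
  lo_trans : transitive lo_le;
  lo_mul2l : forall f g h : G, lo_le f g -> lo_le (h * f) (h * g)
}.

Definition left_orderable (G : groupType) : Prop :=
  exists _ : left_ordering G, True.

HB.instance Definition _ (G : groupType) := gen_eqMixin (left_ordering G).
HB.instance Definition _ (G : groupType) := gen_choiceMixin (left_ordering G).

Lemma left_ordering_eq (G : groupType) (r s : left_ordering G) :
  lo_le r =2 lo_le s -> r = s.
Proof.
case: r s => [r r1 r2 r3 r4] [s s1 s2 s3 s4] /= rs.
have {}rs : r = s by apply/funext => x; apply/funext => y; exact: rs.
by subst s; congr LeftOrdering; exact: Prop_irrelevance.
Qed.

Definition lo_base (G : groupType) (F : {fset G}) : set (left_ordering G) :=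
  [set r : left_ordering G | forall f, f \in F -> r 1 f].

Lemma lo_base_cover (G : groupType) :
  \bigcup_(F in [set: {fset G}]) lo_base F = [set: left_ordering G].
Proof. by apply/seteqP; split=> // r _; exists fset0. Qed.

Lemma lo_base_join (G : groupType) (E F : {fset G}) (r : left_ordering G) :
  [set: {fset G}] E -> [set: {fset G}] F -> lo_base E r -> lo_base F r ->
  exists K, [/\ [set: {fset G}] K, lo_base K r &
                lo_base K `<=` lo_base E `&` lo_base F].
Proof.
move=> _ _ rE rF; exists (E `|` F)%fset; split=> //.
  by move=> f; rewrite inE => /orP[/rE|/rF].
by move=> s sEF; split=> f fE; apply: sEF; rewrite inE fE ?orbT.
Qed.

HB.instance Definition _ (G : groupType) := isPointed.Build {fset G} fset0.

HB.instance Definition _ (G : groupType) :=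
  isBaseTopological.Build (left_ordering G)
    (@lo_base_cover G) (@lo_base_join G).

Definition homeomorphic (X Y : topologicalType) : Prop :=
  exists (f : X -> Y) (g : Y -> X),
    [/\ cancel f g, cancel g f, continuous f & continuous g].

(* Main.v *)
From HB Require Import structures.
From mathcomp Require Import all_boot all_order all_algebra.
From mathcomp Require Import zify lra.
From mathcomp Require Import finmap mathcomp_extra boolp classical_sets functions.
From mathcomp Require Import cardinality fsbigop reals topology cantor exp.
Require Import Defs.

Set Implicit Arguments.
Unset Strict Implicit.
Unset Printing Implicit Defensive.

Import Order.TTheory GRing.Theory Num.Theory.

Local Open Scope classical_set_scope.
Local Open Scope group_scope.

(** A countable group has a space of left-orderings that is compact, Hausdorff,
    zero-dimensional and metrizable. By the topological characterization of the
    Cantor set, it remains to show that no left-ordering is isolated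
    ([order_space_homeomorphic]). Suppose that [r] is isolated: it is the only
    left-ordering for which the elements of some finite set [F] are positive. The
    claim is that the group then has polynomial growth.

    The first ingredient is dynamical ([affine_action]): every order on a nontrivial
    virtually polycyclic group [D] comes with an action of [D] on the line by
    orientation preserving affine maps, such that an element that moves the origin up
    is positive. Indeed, let [C] be the largest proper convex subgroup of [D]. A
    normal subgroup [A] of [D] that is abelian modulo [C], but not contained in it,
    is cofinal in [D]. Hoelder's theorem gives the elements of [A] translation
    numbers, conjugation by [D] rescales these numbers, and the cut that an element
    of [D] makes in them ([position]) is the image of the origin. If the translation
    numbers are dense, this is an affine action. If they are discrete, [position] is
    only a quasimorphism; this forces [A] to have finite index for a suitable choice
    of [A], and the quasimorphism is averaged into a homomorphism.

    The second ingredient is that an order may be changed arbitrarily on a convex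
    subgroup ([order_change]). The stabilizer of the origin is convex, and its rank is
    smaller than that of [D]. Moving the origin a little, or adding to the cocycle a
    small multiple of a homomorphism, gives a new order, for which the elements of
    [F] are still positive if the direction of the change is well chosen; an
    induction on the rank shows that it can be. Since [r] is isolated, the new order
    is the old one, so the affine action consists of translations, and [D] has only
    one homomorphism to the reals up to scaling ([isolated_unique_hom]).

    As [D] is finitely generated, this homomorphism can be taken integer valued, and
    by uniqueness conjugation can only change its sign. The successive kernels form a
    series of normal subgroups with infinite cyclic quotients on which the group acts
    by signs ([isolated_sign_series]). A group with such a series has polynomial
    growth ([sign_series_growth]), which contradicts exponential growth. *)

(** * Subgroups of infinite groups *)

Section Subgroups.
Context {G : groupType}.
Implicit Types (x y : G) (H K N D A : set G).

Lemma sg1 H : subgroup H -> H 1. Proof. by case. Qed.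
Lemma sgM H x y : subgroup H -> H x -> H y -> H (x * y).
Proof. by case=> _ + _; exact. Qed.
Lemma sgV H x : subgroup H -> H x -> H x^-1.
Proof. by case=> _ _; exact. Qed.
Lemma sgX H x n : subgroup H -> H x -> H (x ^+ n).
Proof.
move=> sH Hx; elim: n => [|n IH]; first exact: sg1.
by rewrite expgS; apply: sgM.
Qed.
Lemma sgJ H x y : subgroup H -> H x -> H y -> H (x ^ y).
Proof. by move=> sH Hx Hy; rewrite /conjg; do !apply: sgM => //; exact: sgV. Qed.
Lemma sgR H x y : subgroup H -> H x -> H y -> H [~ x, y].
Proof. by move=> sH Hx Hy; apply: sgM => //; [exact: sgV|exact: sgJ]. Qed.
Lemma sgVr H x : subgroup H -> H x^-1 -> H x.
Proof. by move=> sH /(sgV sH); rewrite invgK. Qed.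
Lemma sgMr H x y : subgroup H -> H x -> H (x * y) -> H y.
Proof. by move=> sH Hx /(sgM sH (sgV sH Hx)); rewrite mulKg. Qed.
Lemma sgMl H x y : subgroup H -> H y -> H (x * y) -> H x.
Proof. by move=> sH Hy Hxy; move: (sgM sH Hxy (sgV sH Hy)); rewrite mulgK. Qed.

Lemma subgroupI H K : subgroup H -> subgroup K -> subgroup (H `&` K).
Proof.
move=> sH sK; split=> [|x y [? ?] [? ?]|x [? ?]].
- by split; exact: sg1.
- by split; exact: sgM.
- by split; exact: sgV.
Qed.

Lemma subgroup_setT : subgroup [set: G]. Proof. by []. Qed.
Lemma subgroup_set1 : subgroup [set (1 : G)].
Proof. by split=> [//|x y -> ->|x ->]; rewrite ?mulg1 ?invg1. Qed.

Definition normal_in (D A : set G) := forall x y, D x -> A y -> A (y ^ x).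

Lemma normal_inV D A x y : subgroup D -> normal_in D A -> D x -> A y ->
  A (x * y * x^-1).
Proof.
move=> sD nA Dx Ay; have := nA _ _ (sgV sD Dx) Ay.
by rewrite /conjg invgK mulgA.
Qed.

Definition zpow x (k : int) : G := if k is Negz n then x ^- n.+1 else x ^+ `|k|%N.

Lemma zpow0 x : zpow x 0 = 1. Proof. by []. Qed.
Lemma zpow1 x : zpow x 1 = x. Proof. by []. Qed.
Lemma zpowN1 x (n : nat) : zpow x (- n%:Z)%R = x ^- n.
Proof. by case: n => [|n]; rewrite ?invg1 // -NegzE. Qed.

Lemma zpowS x (k : int) : zpow x (k + 1)%R = zpow x k * x.
Proof.
case: k => [n|n].
  by rewrite (_ : (Posz n + 1)%R = n.+1) ?[LHS]expgSr //; lia.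
rewrite (_ : (Negz n + 1)%R = - n%:Z)%R; last by lia.
by rewrite zpowN1 [zpow _ _]/= expgS invgM mulgVK.
Qed.

Lemma zpowD x (k l : int) : zpow x (k + l)%R = zpow x k * zpow x l.
Proof.
elim/int_rect: l => [|n IH|n IH]; first by rewrite addr0 zpow0 mulg1.
- by rewrite -addn1 PoszD addrA !zpowS IH mulgA.
- apply: (mulIg x); rewrite -mulgA -!zpowS -addrA.
  by rewrite (_ : (- n.+1%:Z + 1 = - n%:Z)%R) ?IH //; lia.
Qed.

Lemma zpowN x (k : int) : zpow x (- k)%R = (zpow x k)^-1.
Proof. by apply: (mulIg (zpow x k)); rewrite -zpowD addNr zpow0 mulVg. Qed.

Lemma zpowM x (k l : int) : zpow x (k * l)%R = zpow (zpow x k) l.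
Proof.
elim/int_rect: l => [|n IH|n IH]; first by rewrite mulr0.
- by rewrite -addn1 PoszD mulrDr mulr1 [LHS]zpowD IH zpowS.
- apply: (mulIg (zpow x k)); rewrite -zpowD -zpowS.
  by rewrite (_ : (- n.+1%:Z + 1 = - n%:Z)%R) -?IH; [congr zpow|]; lia.
Qed.

Lemma sgZ H x k : subgroup H -> H x -> H (zpow x k).
Proof. by move=> sH Hx; case: k => n; [|apply: sgV => //]; exact: sgX. Qed.

(** Listing representatives, instead of counting cosets, gives a meaning to the
    index of a subgroup [A] that is not contained in [D]. *)
Definition fin_index D A := exists s : seq G,
  forall x, D x -> exists2 r, r \in s & A (r^-1 * x).

(** One representative is picked in each class. The labels are not elements of
    the group in the applications: they are pairs of representatives for an
    intersection, and cosets for an index given by a finite set of cosets. *)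
Lemma fin_index_cover (T : eqType) (s : seq T) (Q : T -> G -> Prop) D A :
  (forall x, D x -> exists2 t, t \in s & Q t x) ->
  (forall t x y, D x -> D y -> Q t x -> Q t y -> A (x^-1 * y)) ->
  fin_index D A.
Proof.
move=> cov QA; exists [seq xget 1 [set x | D x /\ Q t x] | t <- s] => x Dx.
have [t ts Qx] := cov _ Dx; exists (xget 1 [set x | D x /\ Q t x]).
  by apply/mapP; exists t.
by case: xgetP => [y _ [Dy Qy]|/(_ x) []//]; exact: QA Dy Dx Qy Qx.
Qed.

Lemma same_coset A r x y : subgroup A -> A (r^-1 * x) -> A (r^-1 * y) -> A (x^-1 * y).
Proof.
move=> sA /(sgV sA) Ax Ay; have := sgM sA Ax Ay.
by rewrite invgM invgK !mulgA mulgK.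
Qed.

Lemma fin_index_sub D A D' : subgroup A -> subgroup D' -> D' `<=` D ->
  fin_index D A -> fin_index D' (A `&` D').
Proof.
move=> sA sD' DD [s sP]; apply: (@fin_index_cover _ s (fun r x => A (r^-1 * x))).
  by move=> x /DD/sP.
move=> r x y Dx Dy Ax Ay; split; first exact: same_coset Ax Ay.
by apply: sgM => //; exact: sgV.
Qed.

Lemma fin_indexI D A B : subgroup A -> subgroup B ->
  fin_index D A -> fin_index D B -> fin_index D (A `&` B).
Proof.
move=> sA sB [s sP] [s' sP'].
apply: (@fin_index_cover _ [seq (r, r') | r <- s, r' <- s']
  (fun r x => A (r.1^-1 * x) /\ B (r.2^-1 * x))).
  move=> x Dx; have [r rs Ar] := sP _ Dx; have [r' rs' Ar'] := sP' _ Dx.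
  by exists (r, r') => //; apply/allpairsP; exists (r, r').
move=> [r r'] x y Dx Dy /= [Ax Bx] [Ay By].
by split; [exact: same_coset Ax Ay|exact: same_coset Bx By].
Qed.

Lemma fin_index_trans D A B : fin_index D A -> fin_index A B -> fin_index D B.
Proof.
move=> [s sP] [s' sP']; exists [seq r * r' | r <- s, r' <- s'] => x Dx.
have [r rs /sP' [r' rs' Br]] := sP _ Dx.
exists (r * r'); first by apply/allpairsP; exists (r, r').
by rewrite invgM -mulgA.
Qed.

Lemma fin_indexS D A B : A `<=` B -> fin_index D A -> fin_index D B.
Proof. by move=> AB [s sP]; exists s => x /sP[r rs /AB]; exists r. Qed.

(** Two powers of [x] lie in the same coset, by the pigeonhole principle. *)
Lemma fin_index_torsion D A x : subgroup D -> subgroup A -> fin_index D A ->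
  D x -> exists2 m, (0 < m)%N & A (x ^+ m).
Proof.
move=> sD sA [s sP] Dx.
pose rep i := xget 1 [set r | r \in s /\ A (r^-1 * x ^+ i)].
have repP i : rep i \in s /\ A ((rep i)^-1 * x ^+ i).
  have [r rs Ar] := sP _ (sgX i sD Dx).
  by rewrite /rep; case: xgetP => [y _ //|/(_ r) []]; split.
pose f (i : 'I_(size s).+1) : 'I_(size s) :=
  Ordinal (etrans (index_mem (rep i) s) (repP i).1).
have [i [j [ij fij]]] : exists i j : 'I_(size s).+1, (i < j)%N /\ f i = f j.
  apply: contrapT => /forallNP nf.
  have : injective f.
    move=> i j fij; apply/val_inj; case: (ltngtP i j) => // ij.
      by case: (nf i); exists j.
    by case: (nf j); exists i.
  by move/leq_card; rewrite !card_ord ltnn.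
exists (j - i)%N; first by rewrite subn_gt0.
have e : rep i = rep j.
  move: fij => /(congr1 val) /= e; have [ri _] := repP i; have [rj _] := repP j.
  by rewrite -(nth_index 1 ri) -(nth_index 1 rj) e.
have [_ Ai] := repP i; have [_ Aj] := repP j; rewrite -e in Aj.
have := same_coset sA Ai Aj.
by rewrite -{1}(subnKC (ltnW ij)) expgnDr mulKg.
Qed.

Definition fgen D := exists2 s : seq G, (forall x, x \in s -> D x) &
  forall K, subgroup K -> (forall x, x \in s -> K x) -> D `<=` K.

Definition is_hom (V : zmodType) D (phi : G -> V) :=
  forall x y, D x -> D y -> phi (x * y) = (phi x + phi y)%R.

Section Hom.
Context (V : zmodType) (D : set G) (sD : subgroup D) (phi : G -> V).
Hypothesis hphi : is_hom D phi.

Lemma hom1 : phi 1 = 0%R.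
Proof.
have D1 := sg1 sD; have := hphi D1 D1.
by rewrite mulg1 => /esym/eqP; rewrite -subr_eq0 addrK => /eqP.
Qed.
Lemma homV x : D x -> phi x^-1 = (- phi x)%R.
Proof.
move=> Dx; apply/eqP; rewrite -addr_eq0 -hphi ?mulVg ?hom1 //; exact: sgV.
Qed.
Lemma homX x n : D x -> phi (x ^+ n) = (phi x *+ n)%R.
Proof.
move=> Dx; elim: n => [|n IH]; first by rewrite hom1.
by rewrite expgS hphi ?IH ?mulrS //; exact: sgX.
Qed.
Lemma homZ x k : D x -> phi (zpow x k) = (phi x *~ k)%R.
Proof.
move=> Dx; case: k => n /=; first exact: homX.
by rewrite homV ?homX // ?NegzE ?mulrNz //; exact: sgX.
Qed.
Lemma homJ x y : D x -> D y -> phi (x ^ y) = phi x.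
Proof.
move=> Dx Dy; rewrite /conjg hphi ?hphi ?homV //; first by rewrite addrC addrK.
  exact: sgV.
exact: sgM.
Qed.
Lemma hom_ker : subgroup [set x | D x /\ phi x = 0%R].
Proof.
split=> [|x y [Dx x0] [Dy y0]|x [Dx x0]] /=.
- by split; [exact: sg1|exact: hom1].
- by split; [exact: sgM|rewrite hphi // x0 y0 addr0].
- by split; [exact: sgV|rewrite homV // x0 oppr0].
Qed.
End Hom.

Lemma is_homS (V : zmodType) D D' (phi : G -> V) :
  D' `<=` D -> is_hom D phi -> is_hom D' phi.
Proof. by move=> s h x y /s Dx /s Dy; exact: h. Qed.

(** A value that is positive and least generates the image, by Euclidean
    division. *)
Lemma hom_int_gen D (phi : G -> int) : subgroup D -> is_hom D phi ->
  (exists2 x, D x & phi x != 0%R) ->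
  exists t, [/\ D t, (0 < phi t)%R &
    forall x, D x -> exists k : int, phi x = (k * phi t)%R].
Proof.
move=> sD hphi [x Dx x0].
have ex : exists n, `[< exists2 t, D t & phi t = (n.+1%:Z)%R >].
  exists (`|phi x|%N).-1; apply/asboolP; case: (ltrgtP (phi x) 0) x0 => // x0 _.
    by exists x^-1; [exact: sgV|rewrite (homV sD hphi) //; lia].
  by exists x => //; lia.
case: (ex_minnP ex) => n /asboolP [t Dt tn] nmin.
exists t; split=> // [|y Dy]; first by lia.
exists (phi y %/ phi t)%Z.
have t0 : phi t != 0%R by lia.
have := divz_eq (phi y) (phi t); have := modz_ge0 (phi y) t0.
have := ltz_mod (phi y) t0.
set q := (_ %/ _)%Z; set e := (_ %% _)%Z => e1 e0 e2.
rewrite e2; suff -> : e = 0%R by rewrite addr0.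
apply: contrapT => /eqP en0.
have ez : phi (y * zpow t (- q)%R) = e.
  rewrite hphi //; last exact: sgZ.
  by rewrite (homZ sD) // mulrNz mulrzz e2; lia.
have /nmin : `[< exists2 t, D t & phi t = ((`|e|%N).-1.+1%:Z)%R >].
  apply/asboolP; exists (y * zpow t (- q)%R); last by rewrite ez; lia.
  by apply: sgM => //; exact: sgZ.
by lia.
Qed.

End Subgroups.

(** * Hirsch length *)

Section Hirsch.
Context {G : groupType}.
Implicit Types (x y : G) (H K N D A : set G).

(** An upper bound for the Hirsch length, read off a series. Only the steps
    with an infinite cyclic quotient, given as the kernel of an integer valued
    homomorphism, count. Steps of finite index may fail to be normal, which puts virtually
    polycyclic groups on the same footing as polycyclic ones. *)
Inductive hirsch : nat -> set G -> Prop :=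
| Hirsch1 : hirsch 0 [set 1]
| HirschF n N H : subgroup H -> N `<=` H -> fin_index H N ->
    hirsch n N -> hirsch n H
| HirschZ n H (phi : G -> int) : subgroup H -> is_hom H phi ->
    hirsch n [set x | H x /\ phi x = 0%R] -> hirsch n.+1 H.

Lemma hirsch_subgroup n H : hirsch n H -> subgroup H.
Proof. by case=> // ; exact: subgroup_set1. Qed.

Lemma hirsch_fgen n H : hirsch n H -> fgen H.
Proof.
elim=> {n H} [|n N H sH NH [s sP] hN [s' s'N Ngen]|n H phi sH hphi hN [s sN Ngen]].
- by exists [::] => // K sK _ x ->; exact: sg1.
- exists ([seq r <- s | `[< H r >]] ++ s') => [x|K sK sub x Hx].
    by rewrite mem_cat mem_filter => /orP[/andP[/asboolP]//|/s'N/NH].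
  have [r rs Nr] := sP _ Hx.
  have KN : N `<=` K.
    by apply: Ngen => // y ys; apply: sub; rewrite mem_cat ys orbT.
  rewrite -(mulVKg r x); apply: sgM => //; last exact: KN.
  apply: sub; rewrite mem_cat mem_filter rs andbT; apply/orP; left; apply/asboolP.
  by apply: (sgVr sH); apply: (sgMl sH Hx); exact: NH.
- have [ex|nex] := pselect (exists2 x, H x & phi x != 0%R); last first.
    have HN : H `<=` [set x | H x /\ phi x = 0%R].
      move=> x Hx; split=> //; apply: contrapT => /eqP x0.
      by apply: nex; exists x.
    exists s => [x /sN[]//|K sK /(Ngen _ sK) NK]; exact: subset_trans HN NK.
  have [t [Ht t0 tgen]] := hom_int_gen sH hphi ex.
  exists (t :: s) => [x|K sK sub x Hx].
    by rewrite inE => /predU1P[->|/sN[]//].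
  have Kt : K t by apply: sub; rewrite mem_head.
  have [k xk] := tgen _ Hx.
  rewrite -(mulVKg (zpow t k) x); apply: sgM => //; first exact: sgZ.
  apply: Ngen => //; first by move=> y ys; apply: sub; rewrite inE ys orbT.
  have Hz := sgZ k sH Ht.
  split; first by apply: sgM => //; exact: sgV.
  rewrite hphi // ?(homV sH) // ?(homZ sH) //; last exact: sgV.
  by rewrite mulrzz xk; lia.
Qed.

(** The series of [H] intersected with [K] is a series of [K]. A step that
    counts for [H] and no longer counts for [K] lowers the rank; if there is none,
    then [K] loses only a finite index at each step. The rank therefore measures
    progress in inductions over convex subgroups. *)
Lemma hirsch_sub n H K : hirsch n H -> subgroup K -> K `<=` H ->
  (exists2 m, (m < n)%N & hirsch m K) \/ (hirsch n K /\ fin_index H K).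
Proof.
move=> hH; elim: hH K => {n H} [|n N H sH NH fi hN IH|n H phi sH hphi hN IH] K sK KH.
- have -> : K = [set 1] by apply/seteqP; split=> // _ ->; exact: sg1.
  right; split; first exact: Hirsch1.
  by exists [:: 1] => x ->; exists 1; rewrite ?mem_head ?mulg1 ?invg1.
- have sN := hirsch_subgroup hN.
  have fiK : fin_index K (N `&` K) by exact: fin_index_sub fi.
  have [|x [] //|[m mn hK]|[hK fN]] := IH (N `&` K).
  + exact: subgroupI.
  + left; exists m => //; apply: HirschF hK => //; exact: subIsetr.
  + right; split; first by apply: HirschF hK => //; exact: subIsetr.
    apply: fin_indexS (fin_index_trans fi fN); exact: subIsetr.
- set N := [set x | _] in hN IH.
  have sN : subgroup N := hirsch_subgroup hN.
  have eN : [set x | K x /\ phi x = 0%R] = N `&` K.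
    apply/seteqP; split=> [x [Kx x0]|x [[Hx x0] Kx]]; last by split.
    by split=> //; split=> //; exact: KH.
  have hK := is_homS KH hphi.
  have [|x [] //|[m mn hNK]|[hNK fN]] := IH (N `&` K).
  + exact: subgroupI.
  + left; exists m.+1; first by [].
    by apply: (@HirschZ _ _ phi) => //; rewrite eN.
  + have [ex|nex] := pselect (exists2 x, K x & phi x != 0%R); last first.
      left; exists n => //; suff -> : K = N `&` K by [].
      rewrite -eN; apply/seteqP; split=> [x Kx|x []//].
      by split=> //; apply: contrapT => /eqP x0; apply: nex; exists x.
    right; split; first by apply: (@HirschZ _ _ phi) => //; rewrite eN.
    have [t [Kt t0 _]] := hom_int_gen sK hK ex.
    have [s sP] := fN.
    pose h i := xget 1 [set x | H x /\ phi x = i%:Z%R].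
    exists [seq h i * r | i <- iota 0 `|phi t|%N, r <- s] => x Hx.
    have Ht := KH _ Kt.
    set q := (phi x %/ phi t)%Z; set i := (phi x %% phi t)%Z.
    have e : phi x = (q * phi t + i)%R := divz_eq _ _.
    have i0 : (0 <= i)%R by apply: modz_ge0; lia.
    have it : (i < phi t)%R by have := @ltz_mod (phi x) (phi t); rewrite -/i; lia.
    have Hq := sgZ (- q)%R sH Ht.
    have phiq : phi (x * zpow t (- q)%R) = `|i|%N.
      by rewrite hphi // (homZ sH) // mulrNz mulrzz e; lia.
    have [Hh hi] : [set x | H x /\ phi x = `|i|%N%:Z%R] (h `|i|%N).
      by rewrite /h; apply: (@xgetI _ _ _ (x * zpow t (- q)%R)); split=> //; exact: sgM.
    have [|r rs [Nr Kr]] := sP ((h `|i|%N)^-1 * (x * zpow t (- q)%R)).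
      split; first by do !apply: sgM => //; exact: sgV.
      by rewrite hphi ?(homV sH) // ?phiq ?hi ?addNr //; [exact: sgV|exact: sgM].
    exists (h `|i|%N * r).
      by apply/allpairsP; exists (`|i|%N, r); split=> //; rewrite mem_iota /=; lia.
    rewrite invgM -!mulgA.
    apply: (sgMl sK (sgZ (- q)%R sK Kt)); move: Kr; by rewrite -!mulgA.
Qed.

Lemma hirsch_le n H K : hirsch n H -> subgroup K -> K `<=` H ->
  exists m, hirsch m K.
Proof.
by move=> hH sK KH; have [[m _ ?]|[? _]] := hirsch_sub hH sK KH; [exists m|exists n].
Qed.

(** The cyclic quotient is finite when a power of [t] falls into [N]; otherwise
    the exponent of [t] modulo [N] is an integer valued homomorphism. *)
Lemma hirsch_cyclic n H N t : subgroup H -> hirsch n N -> N `<=` H ->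
  (forall x y, H x -> H y -> N [~ x, y]) -> H t ->
  exists N' m, [/\ hirsch m N', N `<=` N', N' `<=` H & N' t].
Proof.
move=> sH hN NH HN Ht; have sN := hirsch_subgroup hN.
have nN x y : H x -> N y -> N (y ^ x).
  move=> Hx Ny; rewrite -(mulVKg y (y ^ x)); apply: sgM => //.
  by apply: HN => //; exact: NH.
pose N' := [set x | exists k, N ((zpow t k)^-1 * x)].
have NN' : N `<=` N' by move=> x Nx; exists 0%R; rewrite zpow0 invg1 mul1g.
have N'H : N' `<=` H.
  move=> x [k /NH]; apply: sgMr => //; apply: sgV => //; exact: sgZ.
have N't : N' t by exists 1%R; rewrite zpow1 mulVg; exact: sg1.
have N'M x y k l : N ((zpow t k)^-1 * x) -> N ((zpow t l)^-1 * y) ->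
    N ((zpow t (k + l)%R)^-1 * (x * y)).
  move=> Nx Ny; have := sgM sN (nN _ _ (sgZ l sH Ht) Nx) Ny.
  by rewrite /conjg zpowD invgM -!mulgA mulVKg.
have sN' : subgroup N'.
  split; first by apply: NN'; exact: sg1.
    by move=> x y [k Nx] [l Ny]; exists (k + l)%R; exact: N'M.
  move=> x [k Nx]; exists (- k)%R; rewrite zpowN invgK.
  have := nN _ _ (sgV sH (sgZ k sH Ht)) (sgV sN Nx).
  by rewrite /conjg !invgK invgM invgK -!mulgA mulgV mulg1.
exists N'; have [[m m0 Nm]|nm] := pselect (exists2 m, (0 < m)%N & N (t ^+ m)).
  exists n; split=> //; apply: (HirschF sN' NN' _ hN).
  exists [seq t ^+ i | i <- iota 0 m] => x [k Nk].
  have m0' : (m%:Z != 0)%R by lia.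
  have := divz_eq k m; have := modz_ge0 k m0'; have := ltz_mod k m0'.
  set q := (k %/ _)%Z; set i := (k %% _)%Z => im i0 e.
  exists (t ^+ `|i|%N); first by apply/mapP; exists `|i|%N => //; rewrite mem_iota; lia.
  have := sgM sN (sgZ q sN Nm) Nk.
  rewrite e addrC zpowD.
  have -> : zpow t i = t ^+ `|i|%N by rewrite -{1}(gez0_abs i0).
  rewrite [(q * m)%R]mulrC zpowM /= -/(zpow _ _) invgM !mulgA.
  by rewrite mulgV mul1g.
have kuniq x k l : N ((zpow t k)^-1 * x) -> N ((zpow t l)^-1 * x) -> k = l.
  move=> Nk Nl; have := sgM sN Nk (sgV sN Nl).
  rewrite invgM invgK mulgA mulgK -zpowN -zpowD => Nkl.
  have {}Nkl : N (t ^+ `|(- k + l)%R|%N).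
    by case: (- k + l)%R Nkl => p //= /(sgV sN); rewrite invgK.
  apply: contrapT => kl; apply: nm; exists `|(- k + l)%R|%N => //; lia.
pose phi x := xget 0%R [set k | N ((zpow t k)^-1 * x)].
have phiP x : N' x -> N ((zpow t (phi x))^-1 * x).
  by move=> [k Nk]; rewrite /phi; case: xgetP => // /(_ k).
have hphi : is_hom N' phi.
  move=> x y N'x N'y; apply: (kuniq (x * y)); last by apply: N'M; exact: phiP.
  by apply: phiP; exact: sgM.
exists n.+1; split=> //; apply: (HirschZ sN' hphi).
suff -> : [set x | N' x /\ phi x = 0%R] = N by [].
apply/seteqP; split=> x.
  by move=> [/phiP + x0]; rewrite x0 zpow0 invg1 mul1g.
move=> Nx; split; first exact: NN'.
apply: (kuniq x); first by apply: phiP; exact: NN'.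
by rewrite zpow0 invg1 mul1g.
Qed.

(** The generators are adjoined one at a time; every intermediate group
    contains the commutators of [H] and is thus normal. *)
Lemma hirsch_abelian_ext n H N (s : seq G) : subgroup H -> hirsch n N ->
  N `<=` H -> (forall x y, H x -> H y -> N [~ x, y]) ->
  (forall x, x \in s -> H x) ->
  (forall K, subgroup K -> N `<=` K -> (forall x, x \in s -> K x) -> H `<=` K) ->
  exists m, hirsch m H.
Proof.
move=> sH; elim: s n N => [|t s IH] n N hN NH HN sH' gen.
  exists n; suff -> : H = N by []; apply/seteqP; split=> //.
  by apply: gen => //; exact: hirsch_subgroup hN.
have [|N' [m [hN' NN' N'H N't]]] := hirsch_cyclic sH hN NH HN (t := t).
  by apply: sH'; rewrite mem_head.
apply: (IH m N') => //.
- by move=> x y Hx Hy; apply: NN'; exact: HN.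
- by move=> x xs; apply: sH'; rewrite inE xs orbT.
- move=> K sK NK sK'; apply: gen => //; first exact: subset_trans NK.
  by move=> x; rewrite inE => /predU1P[->|/sK'//]; exact: NK.
Qed.

End Hirsch.

(** * The derived series of a virtually polycyclic group *)

Section Derived.
Context {G : groupType}.
Implicit Types (x y : G) (H K N D A : set G).

Lemma subgroup_generated (S : set G) : subgroup (generated S).
Proof.
split=> [K [sK _]|x y Sx Sy K [sK SK]|x Sx K [sK SK]].
- exact: sg1.
- by apply: sgM => //; [apply: Sx|apply: Sy].
- by apply: sgV => //; apply: Sx.
Qed.

Lemma generated_min (S K : set G) : subgroup K -> S `<=` K -> generated S `<=` K.
Proof. by move=> sK SK x; apply. Qed.

Lemma subset_generated (S : set G) : S `<=` generated S.
Proof. by move=> x Sx K [_]; exact. Qed.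

Lemma derivedR H x y : H x -> H y -> derived H [~ x, y].
Proof. by move=> Hx Hy; apply: subset_generated; exists x => //; exists y. Qed.

Lemma derived_sub H : subgroup H -> derived H `<=` H.
Proof.
by move=> sH; apply: generated_min => // _ [x Hx [y Hy <-]]; exact: sgR.
Qed.

Lemma derivedS H K : H `<=` K -> derived H `<=` derived K.
Proof.
move=> HK; apply: generated_min; first exact: subgroup_generated.
by move=> _ [x Hx [y Hy <-]]; apply: derivedR; exact: HK.
Qed.

Lemma normal_in_derived D H : normal_in D H -> normal_in D (derived H).
Proof.
move=> nH x y Dx; apply: (@generated_min _ [set y | derived H (y ^ x)]).
  split=> [|u v|u] /=; rewrite ?conj1g ?conjMg ?conjVg.
  - exact: sg1 (subgroup_generated _).
  - exact: sgM (subgroup_generated _).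
  - exact: sgV (subgroup_generated _).
by move=> _ [u Hu [v Hv <-]] /=; rewrite conjRg; apply: derivedR; exact: nH.
Qed.

Lemma subgroup_derived_series H i : subgroup H -> subgroup (derived_series H i).
Proof. by case: i => // i _; exact: subgroup_generated. Qed.

Lemma derived_seriesS H K i : H `<=` K -> derived_series H i `<=` derived_series K i.
Proof. by move=> HK; elim: i => // i; exact: derivedS. Qed.

Lemma fin_index_lcosets H : subgroup H -> finite_set (lcosets [set: G] H) ->
  fin_index [set: G] H.
Proof.
move=> sH /finite_seqP [s sE].
apply: (@fin_index_cover _ _ s (fun c x => c = lcoset x H)).
  move=> x _; exists (lcoset x H) => //.
  have : lcosets [set: G] H (lcoset x H) by exists x.
  by rewrite sE.
move=> c x y _ _ -> xy; have : lcoset x H y.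
  by rewrite xy; exists 1; [exact: sg1|rewrite mulg1].
by move=> [z Hz <-]; rewrite mulKg.
Qed.

Definition core H : set G := [set x | forall g, H (x ^ g)].

Lemma subgroup_core H : subgroup H -> subgroup (core H).
Proof.
move=> sH; split=> [g|x y Hx Hy g|x Hx g]; rewrite ?conj1g ?conjMg ?conjVg.
- exact: sg1.
- exact: sgM.
- exact: sgV.
Qed.

Lemma core_sub H : core H `<=` H.
Proof. by move=> x /(_ 1); rewrite conjg1. Qed.

Lemma normal_core H : normal_in [set: G] (core H).
Proof. by move=> x y _ Hy g; rewrite -conjgM. Qed.

(** Conjugates of [H] by elements of the same coset coincide, so the core is an
    intersection of finitely many conjugates. *)
Lemma fin_index_core H : subgroup H -> fin_index [set: G] H ->
  fin_index [set: G] (core H).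
Proof.
move=> sH fH; have [s sP] := fH.
have sI (s' : seq G) : subgroup [set x | forall r, r \in s' -> H (x ^ r)].
  split=> [r rs|x y Hx Hy r rs|x Hx r rs]; rewrite ?conj1g ?conjMg ?conjVg.
  - exact: sg1.
  - by apply: sgM => //; [exact: Hx|exact: Hy].
  - by apply: sgV => //; exact: Hx.
have fI (s' : seq G) : fin_index [set: G] [set x | forall r, r \in s' -> H (x ^ r)].
  elim: s' => [|g s' IH]; first by exists [:: 1] => x _; exists 1; rewrite ?mem_head.
  have sg : subgroup [set x | H (x ^ g)].
    split=> [|x y|x] /=; rewrite ?conj1g ?conjMg ?conjVg.
    - exact: sg1.
    - exact: sgM.
    - exact: sgV.
  have fg : fin_index [set: G] [set x | H (x ^ g)].
    apply: (@fin_index_cover _ _ s (fun r x => H (r^-1 * x ^ g))).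
      by move=> x _; exact: sP.
    by move=> r x y _ _ /= Hx Hy; rewrite conjMg conjVg; exact: same_coset Hx Hy.
  apply: fin_indexS (fin_indexI sg (sI s') fg IH).
  by move=> x [xg xs] r; rewrite inE => /predU1P[->|/xs].
apply: fin_indexS (fI s) => x xs g.
have [r rs Hr] := sP g I.
by rewrite -(mulVKg r g) conjgM; apply: sgJ => //; exact: xs.
Qed.

(** The terms are normal in the whole group, so that intersecting the chain with
    any subgroup gives normal subgroups of that subgroup. *)
Definition solvable_chain (C : nat -> set G) :=
  [/\ forall i, subgroup (C i), forall i, normal_in [set: G] (C i),
      fin_index [set: G] (C 0),
      forall i x y, C i x -> C i y -> C i.+1 [~ x, y] &
      exists k, C k `<=` [set 1]].

Lemma virtually_polycyclic_chain : virtually_polycyclic G ->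
  exists C : nat -> set G, solvable_chain C.
Proof.
move=> [H [sH fH [[k Hk] _]]]; exists (derived_series (core H)); split.
- by move=> i; apply: subgroup_derived_series; exact: subgroup_core.
- by elim=> [|i IH]; [exact: normal_core|exact: normal_in_derived].
- by apply: fin_index_core => //; exact: fin_index_lcosets.
- by move=> i x y Nx Ny; exact: derivedR.
- by exists k; rewrite -Hk; apply: derived_seriesS; exact: core_sub.
Qed.

Lemma virtually_polycyclic_hirsch : virtually_polycyclic G ->
  exists n, hirsch n [set: G].
Proof.
move=> [H [sH fH [[k Hk] fg]]].
suff [n hn] : exists n, hirsch n H.
  by exists n; apply: HirschF hn => //; exact: fin_index_lcosets.
suff /(_ k (leqnn k)) : forall i, (i <= k)%N ->
    exists n, hirsch n (derived_series H (k - i)) by rewrite subnn.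
elim=> [_|i IH ik]; first by exists 0%N; rewrite subn0 Hk; exact: Hirsch1.
have [n hn] := IH (ltnW ik); set j := (k - i.+1)%N.
have ej : (k - i = j.+1)%N by rewrite /j; lia.
rewrite ej in hn; have sj := subgroup_derived_series j sH.
have [S [SH eS]] := fg j.
apply: (hirsch_abelian_ext (s := S) sj hn) => //.
- exact: derived_sub.
- by move=> x y; exact: derivedR.
- move=> K sK NK SK x Hx.
  have : lcosets (derived_series H j) (derived_series H j.+1)
    (lcoset x (derived_series H j.+1)) by exists x.
  rewrite eS => -[y Sy xy].
  have : lcoset y (derived_series H j.+1) x.
    rewrite xy; exists 1; last by rewrite mulg1.
    exact: sg1 (subgroup_derived_series _ sH).
  move=> [z Nz <-]; apply: sgM => //; last exact: NK.
  by apply: (generated_min sK _ Sy) => u; exact: SK.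
Qed.

End Derived.

(** * Convex subgroups of a left-ordered group *)

Section Orders.
Context {G : groupType} (r : left_ordering G).
Implicit Types (x y z : G) (H K N D A C E : set G).

Lemma lo_refl x : r x x. Proof. by have := lo_total r x x; rewrite orbb. Qed.

Lemma lo_mul2lE h x y : r (h * x) (h * y) = r x y.
Proof.
apply/idP/idP; last exact: lo_mul2l.
by move=> /(lo_mul2l h^-1); rewrite !mulKg.
Qed.

Lemma lo_div x y : r x y = r 1 (x^-1 * y).
Proof. by rewrite -[RHS](lo_mul2lE x) mulg1 mulVKg. Qed.

Lemma lo_tot x : r 1 x \/ r 1 x^-1.
Proof.
have /orP[->|] := lo_total r 1 x; first by left.
by rewrite lo_div mulg1; right.
Qed.

Lemma lo_anti1 x : r 1 x -> r 1 x^-1 -> x = 1.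
Proof.
move=> x1; rewrite -(lo_mul2lE x) mulg1 mulgV => x2.
by apply: (@lo_anti _ r); rewrite x1 x2.
Qed.

Lemma lo_geM x y : r 1 x -> r 1 y -> r 1 (x * y).
Proof. by move=> x1 y1; apply: (lo_trans x1); rewrite lo_div mulKg. Qed.

Lemma lo_geX x n : r 1 x -> r 1 (x ^+ n).
Proof.
by move=> x1; elim: n => [|n IH]; [exact: lo_refl|rewrite expgS; exact: lo_geM].
Qed.

(** For subgroups, left translation reduces convexity to intervals that start
    at [1]. *)
Definition convex D C := [/\ subgroup C, C `<=` D &
  forall x y, C x -> D y -> r 1 y -> r y x -> C y].

Definition proper D C := exists2 d, D d & ~ C d.

Lemma convex1 D : subgroup D -> convex D [set 1].
Proof.
move=> sD; split; first exact: subgroup_set1.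
  by move=> _ ->; exact: sg1.
move=> _ y -> _ y1 y2; apply: lo_anti1 => //.
by rewrite -(lo_mul2lE y) mulg1 mulgV.
Qed.

Lemma convex_refl D : subgroup D -> convex D D. Proof. by move=> sD; split. Qed.

(** A positive element of [C] outside [E] bounds [E] from above. *)
Lemma convex_comparable D C E : convex D C -> convex D E -> C `<=` E \/ E `<=` C.
Proof.
move=> [sC CD cC] [sE ED cE].
have [CE|nCE] := pselect (C `<=` E); [by left|right].
have [x [Cx nEx x1]] : exists x, [/\ C x, ~ E x & r 1 x].
  have [x /not_implyP[Cx nEx]] : exists x, ~ (C x -> E x) by apply/existsNP.
  have [x1|x1] := lo_tot x; first by exists x.
  by exists x^-1; split=> //; [exact: sgV|move=> /(sgVr sE)].
have key y : E y -> r 1 y -> C y.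
  move=> Ey y1; apply: (cC x) => //; first exact: ED.
  have /orP[//|xy] := lo_total r y x.
  by case: nEx; apply: (cE y) => //; exact: CD.
move=> y Ey; have [y1|y1] := lo_tot y; first exact: key.
by apply: (sgVr sC); apply: key => //; exact: sgV.
Qed.

(** A positive element lies below its powers. *)
Lemma convex_torsion D C x m : subgroup D -> convex D C -> D x -> (0 < m)%N ->
  C (x ^+ m) -> C x.
Proof.
move=> sD [sC CD cC].
have key z : D z -> (0 < m)%N -> r 1 z -> C (z ^+ m) -> C z.
  move=> Dz + z1 Cm; case: m Cm => // m Cm _; apply: (cC (z ^+ m.+1)) => //.
  by rewrite lo_div expgS mulKg lo_geX.
move=> Dx m0 Cx; have [x1|x1] := lo_tot x; first exact: key.
by apply: (sgVr sC); apply: key => //; [exact: sgV|rewrite expVgn; exact: sgV].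
Qed.

Lemma convex_fin_index D C : subgroup D -> convex D C -> fin_index D C -> D `<=` C.
Proof.
move=> sD cC fC x Dx; have [sC _ _] := cC.
by have [m m0] := fin_index_torsion sD sC fC Dx; exact: convex_torsion sD cC Dx m0.
Qed.

Definition max_convex D C := [/\ convex D C, proper D C &
  forall E, convex D E -> proper D E -> E `<=` C].

(** The union of all proper convex subgroups, which form a chain, is proper
    because finitely many generators would all lie in one of them. *)
Lemma max_convex_exists D : subgroup D -> fgen D -> proper D [set 1] ->
  exists C, max_convex D C.
Proof.
move=> sD [s sD' gen] pD.
pose C := [set x | exists E, [/\ convex D E, proper D E & E x]].
have inC E : convex D E -> proper D E -> E `<=` C by move=> cE pE x Ex; exists E.
have cup x y : C x -> C y -> exists E, [/\ convex D E, proper D E, E x & E y].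
  move=> [E [cE pE Ex]] [F [cF pF Fy]].
  have [EF|FE] := convex_comparable cE cF.
    by exists F; split=> //; exact: EF.
  by exists E; split=> //; exact: FE.
have CD : C `<=` D by move=> x [E [[_ ED _] _ /ED]].
exists C; split=> //.
  split=> //.
    split.
    - exact: (inC _ (convex1 sD) pD).
    - move=> x y Cx Cy; have [E [cE pE Ex Ey]] := cup _ _ Cx Cy.
      by exists E; split=> //; apply: sgM => //; case: cE.
    - move=> x [E [cE pE Ex]]; exists E; split=> //.
      by apply: sgV => //; case: cE.
  move=> x y [E [cE pE Ex]] Dy y1 yx; exists E; split=> //.
  by case: cE => _ _ cE; apply: (cE x).
apply: contrapT => nC.
have {nC}DC : D `<=` C by move=> x Dx; apply: contrapT => nCx; apply: nC; exists x.
have [E [cE [d Dd nEd] sE]] : exists E, [/\ convex D E, proper D E & forall x, x \in s -> E x].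
  elim: s sD' {gen} => [|x s IH] sD'; first by exists [set 1]; split=> //; exact: convex1.
  have [|E [cE pE sE]] := IH; first by move=> y ys; apply: sD'; rewrite inE ys orbT.
  have [F [cF pF Fx]] : C x by apply: DC; apply: sD'; rewrite mem_head.
  have [EF|FE] := convex_comparable cE cF.
    by exists F; split=> // y; rewrite inE => /predU1P[->//|/sE/EF].
  by exists E; split=> // y; rewrite inE => /predU1P[->|/sE//]; exact: FE.
by apply: nEd; apply: (gen E) => //; case: cE.
Qed.

(** The convex hull of a normal subgroup is a subgroup, so a normal subgroup
    is cofinal unless it lies in the largest proper convex subgroup. *)
Lemma normal_cofinal D C A : subgroup D -> max_convex D C -> subgroup A ->
  A `<=` D -> normal_in D A -> ~ A `<=` C ->
  forall x, D x -> exists a b, [/\ A a, A b, r a x & r x b].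
Proof.
move=> sD [_ _ maxC] sA AD nA nAC x Dx.
pose E := [set x | D x /\ exists a b, [/\ A a, A b, r a x & r x b]].
have AE : A `<=` E.
  by move=> a Aa; split; [exact: AD|exists a, a; split=> //; exact: lo_refl].
have cE : convex D E.
  split; last 2 first.
  - by move=> y [].
  - move=> y z [Dy [a [b [Aa Ab _ yb]]]] Dz z1 zy; split=> //.
    by exists 1, b; split=> //; [exact: sg1|exact: lo_trans zy yb].
  split; first exact: AE (sg1 sA).
  - move=> y z [Dy [a [b [Aa Ab ay yb]]]] [Dz [a' [b' [Aa' Ab' ay' yb']]]].
    split; first exact: sgM.
    exists (y * a' * y^-1 * a), (y * b' * y^-1 * b).
    have J c : A c -> A (y * c * y^-1) by move=> Ac; exact: normal_inV sD nA Dy Ac.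
    split; [by apply: sgM => //; exact: J|by apply: sgM => //; exact: J| |].
    + apply: (@lo_trans _ r (y * a' * y^-1 * y)); first by rewrite lo_mul2lE.
      by rewrite mulgVK lo_mul2lE.
    + apply: (@lo_trans _ r (y * b' * y^-1 * y)); last by rewrite lo_mul2lE.
      by rewrite mulgVK lo_mul2lE.
  - move=> y [Dy [a [b [Aa Ab ay yb]]]]; split; first exact: sgV.
    exists (b^-1 ^ y), (a^-1 ^ y); split.
    + by apply: nA => //; exact: sgV.
    + by apply: nA => //; exact: sgV.
    + by rewrite -(lo_mul2lE (b * y)) /conjg !mulgA mulgK mulgV mul1g.
    + by rewrite -(lo_mul2lE (a * y)) /conjg !mulgA mulgK mulgV mul1g.
have [[//]|nEx] := pselect (E x).
by case: nAC; apply: subset_trans AE (maxC _ cE _); exists x.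
Qed.

(** The strictly positive elements of the order induced on the cosets of [C] *)
Definition above C x := r 1 x /\ ~ C x.

Lemma above_mulC D C p k : subgroup D -> convex D C -> D p -> above C p -> C k ->
  above C (p * k).
Proof.
move=> sD [sC CD co] Dp [p1 nCp] Ck; split; last by move=> /(sgMl sC Ck).
have [//|] := lo_tot (p * k); rewrite invgM => h; case: nCp.
apply: (sgVr sC); apply: (sgMr sC (sgV sC Ck)).
apply: (co k^-1) => //; first exact: sgV.
  by apply: sgM => //; apply: sgV => //; exact: CD.
by rewrite -{2}(mulg1 k^-1) lo_mul2lE lo_div invgK mulg1.
Qed.

End Orders.

(** * Hoelder's theorem *)

Section Holder.
Context {R : realType} {G : groupType} (r : left_ordering G) (D C : set G).
Hypotheses (sD : subgroup D) (mC : max_convex r D C).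
Hypothesis abel : forall x y, D x -> D y -> C [~ x, y].
Implicit Types x y z p q : G.

Let cC : convex r D C. Proof. by case: mC. Qed.
Let sC : subgroup C. Proof. by case: cC. Qed.
Let CD : C `<=` D. Proof. by case: cC. Qed.
Let nC : normal_in D C.
Proof.
move=> x y Dx Cy; rewrite -(mulVKg y (y ^ x)); apply: sgM => //.
by apply: abel => //; exact: CD.
Qed.
Local Notation P := (above r C).

Let aboveM p q : D p -> D q -> P p -> P q -> P (p * q).
Proof.
have [_ _ co] := cC.
move=> Dp Dq [p1 Cp] [q1 Cq]; split; first exact: lo_geM.
move=> Cpq; apply: Cp; apply: (co (p * q)) => //.
by rewrite lo_div mulKg.
Qed.

Let aboveJ p x : D p -> D x -> P p -> P (p ^ x).
Proof.
move=> Dp Dx Pp; rewrite -(mulVKg p (p ^ x)).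
by apply: (above_mulC sD cC) => //; exact: abel.
Qed.

Let aboveP x : [\/ P x, P x^-1 | C x].
Proof.
have [Cx|nCx] := pselect (C x); first exact: Or33.
have [x1|x1] := lo_tot r x; [apply: Or31|apply: Or32]; split=> //.
by move=> /(sgVr sC).
Qed.

Let aboveN x : P x -> ~ P x^-1.
Proof. by move=> [x1 Cx] [x2 _]; apply: Cx; rewrite (lo_anti1 x1 x2); exact: sg1. Qed.

Let cong x y := C (x^-1 * y).

Let congM x x' y y' : D y -> cong x x' -> cong y y' -> cong (x * y) (x' * y').
Proof.
move=> Dy xx yy; rewrite /cong.
have -> : (x * y)^-1 * (x' * y') = (x^-1 * x') ^ y * (y^-1 * y').
  by rewrite /conjg invgM !mulgA mulgK.
by apply: sgM => //; exact: nC.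
Qed.

Let cong_refl x : cong x x. Proof. by rewrite /cong mulVg; exact: sg1. Qed.

Let cong_sym x y : cong x y -> cong y x.
Proof. by rewrite /cong => /(sgV sC); rewrite invgM invgK. Qed.

Let cong_trans x y z : cong x y -> cong y z -> cong x z.
Proof. by rewrite /cong => xy yz; have := sgM sC xy yz; rewrite mulgA mulgK. Qed.

Let congC x y : D x -> D y -> cong (x * y) (y * x).
Proof.
by move=> Dx Dy; have := abel Dy Dx; rewrite /cong commgEl /conjg invgM !mulgA.
Qed.

Let above_cong x y : D x -> P x -> cong x y -> P y.
Proof. by move=> Dx Px xy; rewrite -(mulVKg x y); exact: (above_mulC sD cC). Qed.

Let congX x y n : D x -> D y -> cong ((x * y) ^+ n) (x ^+ n * y ^+ n).
Proof.
move=> Dx Dy; elim: n => [|n IH]; first by rewrite mulg1; exact: cong_refl.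
have Dxn := sgX n sD Dx; have Dyn := sgX n sD Dy.
rewrite !expgS.
apply: (cong_trans (y := x * y * (x ^+ n * y ^+ n))).
  apply: congM (cong_refl _) IH; apply: sgX => //; exact: sgM.
rewrite -!mulgA; apply: congM (cong_refl _) _; first by do !apply: sgM.
by rewrite !mulgA; apply: congM (congC Dy Dxn) (cong_refl _).
Qed.

Let aboveX p n : D p -> P p -> P (p ^+ n.+1).
Proof.
move=> Dp Pp; elim: n => [//|n IH]; rewrite expgS; apply: aboveM => //; exact: sgX.
Qed.

(** The elements bounded by powers of [p] form a convex subgroup that is not
    contained in [C], hence all of [D]. *)
Let archimedean p x : D p -> P p -> D x ->
  exists n, P (x^-1 * p ^+ n.+1) /\ P (x * p ^+ n.+1).
Proof.
move=> Dp Pp Dx.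
pose E := [set x | D x /\ exists n, P (x^-1 * p ^+ n.+1) /\ P (x * p ^+ n.+1)].
have DX n := sgX n sD Dp.
have sE : subgroup E.
  split.
  - split; first exact: sg1.
    by exists 0%N; rewrite invg1 mul1g.
  - move=> y z [Dy [n [yn yn']]] [Dz [m [zm zm']]]; split; first exact: sgM.
    have DVy := sgV sD Dy; have DVz := sgV sD Dz.
    exists (n + m.+1)%N; rewrite -addSn expgnDr; split.
      have -> : (y * z)^-1 * (p ^+ n.+1 * p ^+ m.+1) =
          (y^-1 * p ^+ n.+1) ^ z * (z^-1 * p ^+ m.+1).
        by rewrite /conjg invgM !mulgA mulgK.
      apply: aboveM => //; try apply: aboveJ => //; try apply: sgJ => //; exact: sgM.
    have -> : y * z * (p ^+ n.+1 * p ^+ m.+1) =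
        (y * p ^+ n.+1) * (z * p ^+ m.+1) ^ (p ^+ n.+1).
      by rewrite /conjg !mulgA mulgK -!mulgA -!expgnDr addnC.
    apply: aboveM => //; try apply: aboveJ => //; try apply: sgJ => //; exact: sgM.
  - move=> y [Dy [n [yn yn']]]; split; first exact: sgV.
    by exists n; rewrite invgK.
have [|nxE] := pselect (E x); first by case.
have cE : convex r D E.
  split=> // [y []//|y z [Dy [n [yn yn']]] Dz z1 zy]; split=> //.
  have Dyn := sgM sD (sgV sD Dy) (DX n.+1).
  exists n.+1; split.
    rewrite expgSr (_ : z^-1 * _ = z^-1 * y * (y^-1 * p ^+ n.+1 * p)); last first.
      by rewrite !mulgA mulgK.
    have Pq : P (y^-1 * p ^+ n.+1 * p) by exact: aboveM.
    have Dq : D (y^-1 * p ^+ n.+1 * p) by exact: sgM.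
    have Dzy : D (z^-1 * y) by apply: sgM => //; exact: sgV.
    have [Pz|Pz|Cz] := aboveP (z^-1 * y).
    - exact: aboveM.
    - have [_ []] := Pz; rewrite invgM invgK.
      rewrite (@lo_anti1 _ r (y^-1 * z)); first exact: sg1.
        by case: Pz; rewrite invgM invgK.
      by rewrite invgM invgK -lo_div.
    - apply: (above_cong (x := (y^-1 * p ^+ n.+1 * p) * (z^-1 * y))).
      + by apply: sgM.
      + exact: (above_mulC sD cC).
      + exact: congC.
  rewrite expgSr mulgA.
  have [Pz|Pz|Cz] := aboveP z.
  - rewrite -mulgA; apply: aboveM => //; first exact: sgM.
    by rewrite -expgSr; exact: aboveX.
  - have [_ []] := Pz; rewrite (@lo_anti1 _ r z) ?invg1 //; first exact: sg1.
    by case: Pz.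
  - apply: (above_cong (x := p ^+ n.+1 * p * z)); first by do !apply: sgM.
      apply: (above_mulC sD cC) => //; first by do !apply: sgM.
      by rewrite -expgSr; exact: aboveX.
    by rewrite -mulgA; apply: congC => //; exact: sgM.
have [_ _ maxC] := mC; case: (Pp) => _ []; apply: (maxC E cE); first by exists x.
split=> //; exists 1%N; rewrite expgS expg1 mulKg; split=> //.
by apply: (aboveX 2 Dp Pp).
Qed.

Section Tau.
Context (e : G) (De : D e) (Pe : P e).

(* fractions [m / n] with [e ^ m < x ^ n] modulo [C] *)
Let S x : set R := [set q | exists (m : int) (n : nat),
  q = (m%:~R / n.+1%:R)%R /\ P (zpow e (- m)%R * x ^+ n.+1)].

Let DZ m : D (zpow e m). Proof. exact: sgZ. Qed.
Let PZ (m : int) : (0 < m)%R -> P (zpow e m).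
Proof. by case: m => // -[|n] // _; exact: aboveX. Qed.
Let PZ' (m : int) : P (zpow e m) -> (0 < m)%R.
Proof.
move=> Pm; rewrite ltNge; apply/negP => m0.
have [m00|m0'] := eqVneq m 0%R.
  by move: Pm; rewrite m00 => -[_ []]; exact: sg1.
apply: (aboveN Pm); rewrite -zpowN; apply: PZ; lia.
Qed.

Let S0 x : D x -> (S x) !=set0.
Proof.
move=> Dx; have [n [_ Pn]] := archimedean De Pe Dx.
exists ((- n.+1%:Z)%:~R / 1%:R)%R, (- n.+1%:Z)%R, 0%N; split=> //.
rewrite opprK expg1; apply: (above_cong _ Pn); last exact: congC (sgX _ sD De).
by apply: sgM => //; exact: sgX.
Qed.

Let Sub x : D x -> has_ubound (S x).
Proof.
move=> Dx; have [N [PN _]] := archimedean De Pe Dx.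
have DVx := sgV sD Dx.
exists (N.+1%:R)%R => _ [m [n [-> Pm]]].
have DN := sgX N.+1 sD De.
have P1 : P ((x^-1 * e ^+ N.+1) ^+ n.+1) by apply: aboveX => //; exact: sgM.
have P2 := above_cong (sgX _ sD (sgM sD DVx DN)) P1 (congX n.+1 DVx DN).
have := aboveM _ _ Pm P2; rewrite expVgn !mulgA mulgK => P3.
have {}P3 : P (zpow e (- m)%R * (e ^+ N.+1) ^+ n.+1).
  apply: P3; first by apply: sgM => //; exact: sgX.
  by apply: sgM; [|apply: sgV => //|]; do ?apply: sgX.
move: P3; rewrite -expgnA -[e ^+ _]/(zpow e (N.+1 * n.+1)%N) -zpowD => /PZ' h.
rewrite ler_pdivrMr ?ltr0Sn // -natrM -[X in (_ <= X)%R]/((N.+1 * n.+1)%:Z%:~R)%R ler_int.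
lia.
Qed.

Let tau x : R := sup (S x).

Let tau_ge x (m : int) (n : nat) : D x -> P (zpow e (- m)%R * x ^+ n.+1) ->
  (m%:~R / n.+1%:R <= tau x :> R)%R.
Proof. by move=> Dx Pm; apply: ub_le_sup; [exact: Sub|exists m, n]. Qed.

Let tauM x y : D x -> D y -> (tau x + tau y <= tau (x * y))%R.
Proof.
move=> Dx Dy; rewrite -lerBrDr; apply: ge_sup; first exact: S0.
move=> _ [m [n [-> Pm]]]; rewrite lerBrDr addrC -lerBrDr; apply: ge_sup; first exact: S0.
move=> _ [m' [n' [-> Pm']]]; rewrite lerBrDr addrC.
have -> : (m%:~R / n.+1%:R + m'%:~R / n'.+1%:R =
    (m * n'.+1 + m' * n.+1)%:~R / (n.+1 * n'.+1).-1.+1%:R :> R)%R.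
  by rewrite prednK ?muln_gt0 // natrM intrD !intrM addf_div ?pnatr_eq0 // -!pmulrn.
apply: tau_ge; first exact: sgM.
rewrite prednK ?muln_gt0 //.
have Dxn := sgX n.+1 sD Dx; have Dyn := sgX n'.+1 sD Dy.
have Dem := DZ (- m)%R; have Dem' := DZ (- m')%R.
have D1 := sgM sD Dem Dxn; have D2 := sgM sD Dem' Dyn.
have Q1 := above_cong (sgX _ sD D1) (aboveX n' D1 Pm) (congX n'.+1 Dem Dxn).
have Q2 := above_cong (sgX _ sD D2) (aboveX n D2 Pm') (congX n.+1 Dem' Dyn).
have DX u k : D u -> D (u ^+ k) by exact: sgX.
have D3 := sgM sD (DX _ n'.+1 Dem) (DX _ n'.+1 Dxn).
have D4 := sgM sD (DX _ n.+1 Dem') (DX _ n.+1 Dyn).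
apply: (above_cong (sgM sD D3 D4) (aboveM D3 D4 Q1 Q2)).
rewrite -!expgnA [(n'.+1 * n.+1)%N]mulnC.
apply: (cong_trans (y := zpow e (- m)%R ^+ n'.+1 * (zpow e (- m')%R ^+ n.+1 *
   (x ^+ (n.+1 * n'.+1) * y ^+ (n.+1 * n'.+1))))).
  rewrite -!mulgA; apply: congM (cong_refl _) _.
    by do ?apply: sgM; do ?apply: DX => //.
  rewrite !mulgA; apply: congM; [by apply: DX| |exact: cong_refl].
  by apply: congC; apply: DX.
have -> : zpow e (- (m * n'.+1 + m' * n.+1))%R =
    zpow e (- m)%R ^+ n'.+1 * zpow e (- m')%R ^+ n.+1.
  by rewrite opprD -!mulNr zpowD !zpowM.
rewrite mulgA; apply: congM (cong_refl _) (cong_sym _); last exact: congX.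
by apply: sgM => //; apply: DX.
Qed.

(* [x ^ n] lies between two consecutive powers of [e], so the error on
   [n * tau x] stays bounded *)
Let tauV x : D x -> (0 <= tau x + tau x^-1)%R.
Proof.
move=> Dx; rewrite leNgt; apply/negP => neg.
have DVx := sgV sD Dx.
have [n nlt] : exists n, (3 / n.+1%:R < - (tau x + tau x^-1))%R.
  have d0 : (0 < - (tau x + tau x^-1))%R by rewrite oppr_gt0.
  exists (Num.bound (3 / - (tau x + tau x^-1)))%R.
  rewrite ltr_pdivrMr ?ltr0Sn // mulrC -ltr_pdivrMr //.
  have := archi_boundP (ltW (divr_gt0 (ltr0Sn R 2) d0)).
  by move=> /lt_trans; apply; rewrite ltr_nat.
have Dxn := sgX n.+1 sD Dx.
have ex : exists k : nat, exists m : int, P (zpow e (- m)%R * x ^+ n.+1) /\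
     ~ P (zpow e (- (m + 1))%R * x ^+ n.+1).
  have [N [PN PN']] := archimedean De Pe Dxn.
  apply: contrapT => /forallNP nex.
  have {}nex (k : nat) : P (zpow e (- (- N.+1%:Z + k%:Z))%R * x ^+ n.+1).
    elim: k => [|k IH].
      rewrite addr0 opprK; apply: above_cong PN' _; last exact: congC (sgX _ sD De).
      by apply: sgM => //; exact: sgX.
    apply: contrapT => nP; apply: (nex 0%N); exists (- N.+1%:Z + k%:Z)%R; split=> //.
    by rewrite -addrA -PoszD addn1.
  have := nex (N.+1 + N.+1)%N.
  rewrite (_ : (- (- N.+1%:Z + (N.+1 + N.+1)%N%:Z) = - N.+1%:Z)%R); last by lia.
  move=> /aboveN; apply; rewrite invgM -zpowN opprK; exact: PN.
have [_ [m [Pm nPm]]] := ex.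
have t1 := tau_ge Dx Pm.
have t2 : ((- (m + 2))%:~R / n.+1%:R <= tau x^-1 :> R)%R.
  apply: tau_ge => //; rewrite opprK.
  have D1 : D (zpow e (- (m + 1))%R * x ^+ n.+1) by exact: sgM.
  have -> : (m + 2 = 1 + (m + 1))%R by lia.
  have [//|Q|Q] := aboveP (zpow e (- (m + 1))%R * x ^+ n.+1).
    have := aboveM De (sgV sD D1) Pe Q.
    rewrite invgM -zpowN opprK expVgn => Q'.
    apply: above_cong Q' _; first by apply: sgM => //; apply: sgM => //; exact: sgV.
    rewrite [zpow e (1 + _)%R]zpowD -mulgA; apply: congM (cong_refl _) _.
      by apply: sgM => //; exact: sgV.
    by apply: congC => //; exact: sgV.
  have := above_mulC sD cC De Pe (sgV sC Q).
  rewrite invgM -zpowN opprK expVgn => Q'.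
  apply: above_cong Q' _; first by apply: sgM => //; apply: sgM => //; exact: sgV.
  rewrite [zpow e (1 + _)%R]zpowD -mulgA; apply: congM (cong_refl _) _.
    by apply: sgM => //; exact: sgV.
  by apply: congC => //; exact: sgV.
have := lerD t1 t2; rewrite -mulrDl -intrD (_ : (m + - (m + 2) = - 2)%R); last by lia.
have -> : ((- 2)%:~R = - 2 :> R)%R by rewrite mulrNz.
move: nlt; have : (0 < n.+1%:R^-1 :> R)%R by rewrite invr_gt0 ltr0Sn.
by set i := (n.+1%:R^-1)%R; lra.
Qed.

Let tau1 : (tau 1 <= 0)%R.
Proof.
apply: ge_sup; first exact: S0 (sg1 sD).
move=> _ [m [n [-> Pm]]]; move: Pm; rewrite expg1n mulg1 => /PZ' m0.
rewrite pmulr_lle0 ?invr_gt0 ?ltr0Sn // lerz0; lia.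
Qed.

Lemma holder_aux : exists t : G -> R, is_hom D t /\
  forall x, D x -> (0 < t x)%R <-> P x.
Proof.
have tV x : D x -> tau x^-1 = (- tau x)%R.
  move=> Dx; have := tauV Dx; have := tauM Dx (sgV sD Dx); rewrite mulgV.
  by have := tau1; lra.
exists tau; split=> [x y Dx Dy|x Dx].
  have := tauM Dx Dy; have := tauM (sgV sD Dx) (sgM sD Dx Dy).
  by rewrite mulKg tV //; lra.
split=> [t0|Px]; last first.
  have [n [_ Pn]] := archimedean Dx Px (sgV sD De).
  apply: lt_le_trans (tau_ge (m := 1) (n := n) Dx _); first by rewrite divr_gt0 ?ltr0Sn.
  by rewrite zpowN zpow1.
have [q [m [n [-> Pm]]] q0] : exists2 q, S x q & (0 < q)%R.
  by apply: sup_gt => //; exact: S0.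
have {q0} m0 : (0 < m)%R.
  by move: q0; rewrite pmulr_lgt0 ?invr_gt0 ?ltr0Sn // ltr0z.
have [//|Q|Q] := aboveP x.
  have := aboveM _ _ Pm (aboveX n (sgV sD Dx) Q); rewrite expVgn mulgK => h.
  have D1 : D (zpow e (- m)%R * x ^+ n.+1) by apply: sgM => //; exact: sgX.
  have D2 : D (x ^- n.+1) by apply: sgV => //; exact: sgX.
  by have := PZ' (h D1 D2); lia.
have := above_mulC sD cC _ Pm (sgV sC (sgX n.+1 sC Q)); rewrite mulgK => h.
have D1 : D (zpow e (- m)%R * x ^+ n.+1) by apply: sgM => //; exact: sgX.
by have := PZ' (h D1); lia.
Qed.
End Tau.

(** Since [C] is the largest proper convex subgroup, the ordered abelian group
    [D / C] is Archimedean; measuring its elements by the powers of a fixed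
    positive one embeds it in the reals. *)
Lemma holder : exists t : G -> R, is_hom D t /\
  forall x, D x -> (0 < t x)%R <-> P x.
Proof.
have [_ [e De nCe] _] := mC.
have [Pe|Pe|//] := aboveP e; first exact: holder_aux De Pe.
exact: holder_aux (sgV sD De) Pe.
Qed.

End Holder.

(** * Translation numbers and the position map *)

Section Homs.
Context {R : realType} {G : groupType}.

(** If [t' x] were less than [k * t x], with [k] the ratio at [a], then a product
    [x ^ n * a ^ m] with [0 < t <= t a] would make [t'] negative for large [n]. *)
Lemma hom_proportional (D : set G) (t t' : G -> R) : subgroup D ->
  is_hom D t -> is_hom D t' -> (forall x, D x -> (0 < t x)%R -> (0 <= t' x)%R) ->
  (exists2 x, D x & t x != 0%R) ->
  exists2 k : R, (0 <= k)%R & forall x, D x -> t' x = (k * t x)%R.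
Proof.
move=> sD ht ht' pos [a Da a0].
have {a Da a0} [a Da a0] : exists2 a, D a & (0 < t a)%R.
  have [an|ap|e] := ltgtP (t a) 0%R; last by rewrite e eqxx in a0.
    by exists a^-1; [exact: sgV|rewrite (homV sD ht) // oppr_gt0].
  by exists a.
pose k := (t' a / t a)%R.
have k0 : (0 <= k)%R by apply: divr_ge0; [exact: pos|exact: ltW].
exists k => //.
have ka : t' a = (k * t a)%R by rewrite /k mulfVK // gt_eqF.
suff key x : D x -> (k * t x <= t' x)%R.
  move=> x Dx; apply/eqP; rewrite eq_le key // andbT.
  by have := key x^-1 (sgV sD Dx); rewrite (homV sD ht) // (homV sD ht') // mulrN lerN2.
move=> Dx; rewrite leNgt; apply/negP => lt.
have d0 : (0 < k * t x - t' x)%R by rewrite subr_gt0.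
pose n := Num.bound (k * t a / (k * t x - t' x))%R.
have nlt : (k * t a < n%:R * (k * t x - t' x))%R.
  rewrite -ltr_pdivrMr //; apply: archi_boundP.
  by apply: divr_ge0; [apply: mulr_ge0 => //|]; exact: ltW.
pose m := (Num.floor (- (n%:R * t x) / t a) + 1)%R.
have m1 : (0 < n%:R * t x + m%:~R * t a)%R.
  have := floorD1_gt (- (n%:R * t x) / t a)%R; rewrite -/m ltr_pdivrMr //; lra.
have m2 : (n%:R * t x + m%:~R * t a <= t a)%R.
  have := floor_le (- (n%:R * t x) / t a)%R; rewrite ler_pdivlMr // /m intrD; lra.
pose z := x ^+ n * zpow a m.
have Dn := sgX n sD Dx; have Dm := sgZ m sD Da.
have tz : t z = (n%:R * t x + m%:~R * t a)%R.
  by rewrite ht // (homX sD ht) // (homZ sD ht) // mulr_natl mulrzl.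
have t'z : t' z = (n%:R * t' x + m%:~R * t' a)%R.
  by rewrite ht' // (homX sD ht') // (homZ sD ht') // mulr_natl mulrzl.
have := pos z (sgM sD Dn Dm); rewrite tz t'z => /(_ m1).
have := ler_wpM2l k0 m2; rewrite ka; nra.
Qed.

End Homs.

Section Translation.
Context {R : realType} {G : groupType} (r : left_ordering G).
Context (D C A : set G) (sD : subgroup D) (mC : max_convex r D C).
Context (sA : subgroup A) (AD : A `<=` D) (nA : normal_in D A) (nAC : ~ A `<=` C).
Hypothesis abel : forall x y, A x -> A y -> C [~ x, y].
Hypothesis fgA : fgen A.

(** [A] is only abelian modulo [C], but [A `&` C] is a proper convex subgroup of
    [A] and is thus contained in the largest one, [B]; so Hoelder's theorem
    applies to [A]. *)
Lemma translation_number : exists B (tau : G -> R),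
  [/\ convex r A B, is_hom A tau, exists2 a, A a & (0 < tau a)%R &
      forall a, A a -> (0 < tau a)%R <-> above r B a].
Proof.
have [[sC CD co] _ _] := mC.
have pA : proper A [set 1].
  apply: contrapT => npA; apply: nAC => a Aa.
  have [->|a1] := pselect (a = 1); first exact: sg1.
  by case: npA; exists a.
have [B mB] := max_convex_exists r sA fgA pA.
have CB : A `&` C `<=` B.
  case: mB => _ _; apply; last first.
    by apply: contrapT => nn; apply: nAC => a Aa; apply: contrapT => nCa;
       apply: nn; exists a => // -[].
  split; [exact: subgroupI|by move=> x []|].
  move=> x y [Ax Cx] Ay y1 yx; split=> //; apply: (co x) => //; exact: AD.
have abB x y : A x -> A y -> B [~ x, y].
  by move=> Ax Ay; apply: CB; split; [exact: sgR|exact: abel].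
have [tau [htau tauP]] := holder (R := R) sA mB abB.
have [cB [a Aa nBa] _] := mB; have [sB _ _] := cB.
exists B, tau; split=> //.
have [a1|a1] := lo_tot r a; first by exists a => //; apply/tauP.
exists a^-1; first exact: sgV.
by apply/tauP; [exact: sgV|split=> // /(sgVr sB)].
Qed.

Context (B : set G) (tau : G -> R) (cB : convex r A B) (htau : is_hom A tau).
Context (a0 : G) (Aa0 : A a0) (ta0 : (0 < tau a0)%R).
Hypothesis tauP : forall a, A a -> (0 < tau a)%R <-> above r B a.

Lemma tau_ge0 a : A a -> r 1 a -> (0 <= tau a)%R.
Proof.
move=> Aa a1; rewrite leNgt; apply/negP => an.
have /tauP -/(_ (sgV sA Aa)) [a2 Ba] : (0 < tau a^-1)%R.
  by rewrite (homV sA htau) // oppr_gt0.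
by apply: Ba; rewrite (lo_anti1 a1 a2) invg1; case: cB => /sg1.
Qed.

Lemma tau_mono a b : A a -> A b -> r a b -> (tau a <= tau b)%R.
Proof.
move=> Aa Ab; rewrite lo_div => /tau_ge0; have AVa := sgV sA Aa.
by rewrite htau // (homV sA htau) // addrC subr_ge0; apply; exact: sgM.
Qed.

Let cof x : D x -> exists a b, [/\ A a, A b, r a x & r x b].
Proof. exact: (normal_cofinal sD mC sA AD nA nAC). Qed.

Let AJ a g : A a -> D g -> A (a ^ g). Proof. by move=> Aa Dg; exact: nA. Qed.
Let AX a n : A a -> A (a ^+ n). Proof. exact: sgX. Qed.
Let AM a b : A a -> A b -> A (a * b). Proof. exact: sgM. Qed.
Let DM a b : D a -> D b -> D (a * b). Proof. exact: sgM. Qed.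
Let DV a : D a -> D a^-1. Proof. exact: sgV. Qed.

(** An element with positive translation number moves every point up, not only
    the identity: if it moved [x] down, its powers would keep [x] bounded,
    although they push an element of [A] below [x] beyond every bound. *)
Lemma tau_gt0J a x : A a -> D x -> (0 < tau a)%R -> (0 <= tau (a ^ x))%R.
Proof.
move=> Aa Dx a1; apply: tau_ge0; first exact: AJ.
have [//|h] := lo_tot r (a ^ x).
have axx : r (a * x) x.
  by move: h; rewrite -conjVg -(lo_mul2lE r (a * x)) /conjg !mulgA mulgK mulgV mul1g mulg1.
have anx n : r (a ^+ n * x) x.
  elim: n => [|n IH]; first by rewrite mul1g; exact: lo_refl.
  by apply: lo_trans axx; rewrite expgS -mulgA lo_mul2lE.
have [b [b' [Ab Ab' bx xb']]] := cof Dx.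
pose n := Num.bound `|(tau b' - tau b) / tau a|%R.
have : (tau (a ^+ n * b) <= tau b')%R.
  apply: tau_mono => //; first by apply: AM => //; exact: AX.
  by apply: lo_trans xb'; apply: lo_trans (anx n); rewrite lo_mul2lE.
rewrite htau ?(homX sA htau) //; last exact: AX.
rewrite -lerBrDr -mulr_natl -ler_pdivlMr // leNgt.
by rewrite (le_lt_trans (ler_norm _) (archi_boundP (normr_ge0 _))).
Qed.

(** The factor by which [g] rescales translation numbers; it does not depend on
    [a0] because the conjugate of [tau] by [g] is proportional to [tau]. *)
Definition dil g : R := (tau (a0 ^ g^-1) / tau a0)%R.

Lemma dilP g a : D g -> A a -> tau (a ^ g^-1) = (dil g * tau a)%R.
Proof.
move=> Dg Aa.
have hJ : is_hom A (fun a => tau (a ^ g^-1)).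
  by move=> x y Ax Ay; rewrite conjMg htau //; apply: AJ => //; exact: DV.
have [||k k0 kP] := hom_proportional sA htau hJ.
- by move=> x Ax; apply: tau_gt0J => //; exact: DV.
- by exists a0 => //; rewrite gt_eqF.
by rewrite /dil !kP // mulfK ?gt_eqF.
Qed.

Lemma dil_ge0 g : D g -> (0 <= dil g)%R.
Proof.
by move=> Dg; apply: divr_ge0; [apply: tau_gt0J => //; exact: DV|exact: ltW].
Qed.

Lemma dilM g h : D g -> D h -> dil (g * h) = (dil g * dil h)%R.
Proof.
move=> Dg Dh; rewrite {1}/dil invgM conjgM dilP //; last by apply: AJ => //; exact: DV.
by rewrite dilP // mulrA mulfK // gt_eqF.
Qed.

Lemma dilA a : A a -> dil a = 1%R.
Proof.
by move=> Aa; rewrite /dil (homJ sA htau) ?divff ?gt_eqF //; exact: sgV.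
Qed.

Lemma dil1 : dil 1 = 1%R. Proof. exact: dilA (sg1 sA). Qed.

Lemma dilVM g : D g -> (dil g * dil g^-1)%R = 1%R.
Proof. by move=> Dg; rewrite -dilM ?mulgV ?dil1 //; exact: DV. Qed.

Lemma dil_gt0 g : D g -> (0 < dil g)%R.
Proof.
move=> Dg; rewrite lt0r dil_ge0 // andbT; apply/eqP => g0.
by have /eqP := dilVM Dg; rewrite g0 mul0r eq_sym oner_eq0.
Qed.

(** The cut that [x] makes in the translation numbers: this is a monotone map to
    the line that turns left multiplication by [A] into translations. *)
Definition position x : R := sup [set tau a | a in [set a | A a /\ r a x]].

Let has_sup_position x : D x -> has_sup [set tau a | a in [set a | A a /\ r a x]].
Proof.
move=> Dx; have [a [b [Aa Ab ax xb]]] := cof Dx; split; first by exists (tau a), a.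
exists (tau b) => _ [c [Ac cx] <-]; apply: tau_mono => //; exact: lo_trans cx xb.
Qed.

Lemma position_ge a x : A a -> D x -> r a x -> (tau a <= position x)%R.
Proof.
move=> Aa Dx ax; apply: ub_le_sup; last by exists a.
by case: (has_sup_position Dx).
Qed.

Lemma position_leP x t : D x -> (forall a, A a -> r a x -> (tau a <= t)%R) ->
  (position x <= t)%R.
Proof.
move=> Dx h; apply: ge_sup; first by case: (has_sup_position Dx).
by move=> _ [a [Aa ax] <-]; exact: h.
Qed.

Lemma position_mono x y : D x -> D y -> r x y -> (position x <= position y)%R.
Proof.
move=> Dx Dy xy; apply: position_leP => // a Aa ax.
by apply: position_ge => //; exact: lo_trans ax xy.
Qed.

Lemma positionA a : A a -> position a = tau a.
Proof.
move=> Aa; apply/eqP; rewrite eq_le position_ge ?lo_refl ?andbT //; last exact: AD.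
by apply: position_leP; [exact: AD|move=> b Ab; exact: tau_mono].
Qed.

Lemma position1 : position 1 = 0%R.
Proof. by rewrite positionA ?(hom1 sA htau) //; exact: sg1. Qed.

Lemma position_gt0 x : D x -> (0 < position x)%R -> r 1 x.
Proof.
move=> Dx; have /orP[//|x1] := lo_total r 1 x.
by have := position_mono Dx (sg1 sD) x1; rewrite position1 leNgt => /negbTE ->.
Qed.

Lemma positionMl a x : A a -> D x -> position (a * x) = (tau a + position x)%R.
Proof.
have le b y : A b -> D y -> (position (b * y) <= tau b + position y)%R.
  move=> Ab Dy; apply: position_leP; first by apply: DM => //; exact: AD.
  move=> c Ac; rewrite -lerBlDl -{1}(mulVKg b c) lo_mul2lE => bcy.
  have AVb := sgV sA Ab.
  have := position_ge (AM AVb Ac) Dy bcy.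
  by rewrite htau // (homV sA htau) // addrC.
move=> Aa Dx; apply/eqP; rewrite eq_le le //=.
have := le a^-1 (a * x) (sgV sA Aa) (DM (AD Aa) Dx).
by rewrite mulKg (homV sA htau) //; lra.
Qed.

Lemma positionMr x a : A a -> D x -> position (x * a) = (dil x * tau a + position x)%R.
Proof.
move=> Aa Dx; rewrite -dilP // -positionMl //; last by apply: AJ => //; exact: DV.
by rewrite /conjg invgK !mulgA mulgVK.
Qed.

(** Multiplication by [g] carries the elements of [A] below [x] to elements
    below [g * x], up to right multiplication by [g]. *)
Lemma position_superadd g x : D g -> D x ->
  (dil g * position x + position g <= position (g * x))%R.
Proof.
move=> Dg Dx; rewrite -lerBrDr mulrC -ler_pdivlMr ?dil_gt0 //.
apply: position_leP => // a Aa ax; rewrite ler_pdivlMr ?dil_gt0 // lerBrDr mulrC.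
rewrite -positionMr //; apply: position_mono; [by apply: DM => //; exact: AD|exact: DM|].
by rewrite lo_mul2lE.
Qed.

(** Adding copies of [e] to an element of [A] below [x] passes [x], and the
    first that does overshoots the position by at most [tau e]. *)
Lemma position_upper g x e : D g -> D x -> A e -> (0 < tau e)%R ->
  (position (g * x) <= dil g * (position x + tau e) + position g)%R.
Proof.
move=> Dg Dx Ae e0.
have [b [_ [Ab _ bx _]]] := cof Dx.
pose m := (Num.floor ((position x - tau b) / tau e) + 1)%R.
have Am := sgZ m sA Ae.
have tm : tau (b * zpow e m) = (tau b + m%:~R * tau e)%R.
  by rewrite htau // (homZ sA htau) // mulrzl.
have m1 : (position x < tau (b * zpow e m))%R.
  rewrite tm; have := floorD1_gt ((position x - tau b) / tau e)%R.
  by rewrite -/m ltr_pdivrMr //; lra.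
have m2 : (tau (b * zpow e m) <= position x + tau e)%R.
  rewrite tm; have := floor_le ((position x - tau b) / tau e)%R.
  by rewrite ler_pdivlMr // /m intrD; lra.
have Abm := AM Ab Am.
have xb : r x (b * zpow e m).
  have /orP[//|/(position_ge Abm Dx)] := lo_total r x (b * zpow e m).
  by rewrite leNgt m1.
have Dbm := AD Abm.
have : (position (g * x) <= position (g * (b * zpow e m)))%R.
  by apply: position_mono; [exact: DM|exact: DM|rewrite lo_mul2lE].
rewrite (positionMr Abm Dg) => /le_trans; apply.
by rewrite lerD2r ler_wpM2l // dil_ge0.
Qed.

(** The bounds of [position_superadd] and [position_upper] meet when [tau e] is
    arbitrarily small. *)
Lemma position_cocycle :
  (forall e : R, (0 < e)%R -> exists a, [/\ A a, (0 < tau a)%R & (tau a < e)%R]) ->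
  forall g x, D g -> D x -> position (g * x) = (position g + dil g * position x)%R.
Proof.
move=> dense g x Dg Dx; apply/eqP; rewrite eq_le; apply/andP; split; last first.
  by rewrite addrC; exact: position_superadd.
rewrite leNgt; apply/negP => lt; have l0 := dil_gt0 Dg.
pose d := ((position (g * x) - (position g + dil g * position x)) / dil g)%R.
have d0 : (0 < d)%R by rewrite divr_gt0 // subr_gt0.
have [e [Ae e0 ed]] := dense _ d0.
have := position_upper Dg Dx Ae e0.
move: ed; rewrite /d ltr_pdivlMr // mulrDr mulrC; lra.
Qed.

(** Two distinct values close to the infimum would have a positive difference
    smaller than [e]. *)
Lemma tau_discrete (e : R) : (0 < e)%R ->
  (forall a, A a -> (0 < tau a)%R -> (e <= tau a)%R) ->
  exists t, [/\ A t, (0 < tau t)%R & forall a, A a -> (0 < tau a)%R -> (tau t <= tau a)%R].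
Proof.
move=> e0 eP; apply: contrapT => nex.
pose S := [set tau a | a in [set a | A a /\ (0 < tau a)%R]].
have hS : has_inf S.
  split; first by exists (tau a0), a0.
  by exists 0%R => _ [a [_ /ltW ?] <-].
have [_ [a [Aa ap] <-] ae] := inf_adherent e0 hS.
apply: nex; exists a; split=> // b Ab bp; rewrite leNgt; apply/negP => ba.
have AVb := sgV sA Ab.
have := eP (a * b^-1) (AM Aa AVb); rewrite htau // (homV sA htau) // subr_gt0 => /(_ ba).
have : (inf S <= tau b)%R by apply: ge_inf; [case: hS|exists b].
lra.
Qed.

Section Discrete.
Context (t : G) (At : A t) (t0 : (0 < tau t)%R).
Hypothesis tmin : forall a, A a -> (0 < tau a)%R -> (tau t <= tau a)%R.

(** Neither [g] nor its inverse can shrink the least positive value. *)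
Lemma discrete_dil g : D g -> dil g = 1%R.
Proof.
have ge1 h : D h -> (1 <= dil h)%R.
  move=> Dh; rewrite -(ler_pM2r t0) mul1r -dilP //; apply: tmin.
    by apply: AJ => //; exact: DV.
  by rewrite dilP // mulr_gt0 // dil_gt0.
move=> Dg; apply/eqP; rewrite eq_le ge1 // andbT.
have := ge1 _ (DV Dg); rewrite -(ler_pM2l (dil_gt0 Dg)) dilVM // mulr1; exact.
Qed.

Lemma discrete_tauJ a g : A a -> D g -> tau (a ^ g) = tau a.
Proof. by move=> Aa Dg; rewrite -(invgK g) dilP ?discrete_dil ?mul1r //; exact: DV. Qed.

Lemma position_quasi_le g x : D g -> D x ->
  (position g + position x <= position (g * x))%R.
Proof.
move=> Dg Dx; have := position_superadd Dg Dx; rewrite discrete_dil // mul1r; lra.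
Qed.

Lemma position_quasi_ge g x : D g -> D x ->
  (position (g * x) <= position g + position x + tau t)%R.
Proof.
move=> Dg Dx; have := position_upper Dg Dx At t0; rewrite discrete_dil // mul1r; lra.
Qed.

(** The kernel of [tau] is normal in [D] and bounded above by [a0]; it is not
    cofinal, so it must be contained in [C]. *)
Lemma discrete_kernel a : A a -> tau a = 0%R -> C a.
Proof.
pose K := [set a | A a /\ tau a = 0%R].
have sK : subgroup K := hom_ker sA htau.
move=> Aa ta; apply: contrapT => nCa.
have [|x y Dx [Ay y0]||c [b [_ [Ab b0] _ ab]]] :=
    @normal_cofinal _ r D C K sD mC sK _ _ _ a0 (AD Aa0).
- by move=> x [/AD].
- by split; [exact: AJ|rewrite discrete_tauJ].
- by move=> KC; apply: nCa; apply: KC.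
by have := tau_mono Aa0 Ab ab; rewrite b0 leNgt ta0.
Qed.

(** In the discrete case [position] is a quasimorphism, so conjugating [c] by
    [b ^ n] changes its position by a bounded amount. But each conjugation by [b]
    adds [tau [~ c, b]] to it. *)
Lemma discrete_commutator b c : D b -> D c -> A [~ c, b] -> C [~ c, b].
Proof.
move=> Db Dc Aw.
have cw : c ^ b = c * [~ c, b] by rewrite /commg mulVKg.
set w := [~ c, b] in Aw cw *.
apply: discrete_kernel => //; apply: contrapT => /eqP w0.
have step n : exists2 wn, A wn & c ^ (b ^+ n) = c * wn /\ tau wn = (n%:R * tau w)%R.
  elim: n => [|n [wn An [cn tn]]].
    by exists 1; [exact: sg1|rewrite conjg1 mulg1 (hom1 sA htau) mul0r].
  have AJn := AJ An Db.
  exists (w * wn ^ b); first exact: AM.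
  split; last by rewrite htau // discrete_tauJ // tn -natr1; lra.
  by rewrite expgSr conjgM cn conjMg cw -mulgA.
have bound n : (`|n%:R * tau w| <= 3 * tau t)%R.
  have [wn An [cn tn]] := step n.
  have Dbn := sgX n sD Db; have DVbn := DV Dbn; have Dcb := DM Dc Dbn.
  have p1 := position_quasi_le DVbn Dcb; have p2 := position_quasi_ge DVbn Dcb.
  have p3 := position_quasi_le Dc Dbn; have p4 := position_quasi_ge Dc Dbn.
  have p5 := position_quasi_le DVbn Dbn; have p6 := position_quasi_ge DVbn Dbn.
  have e1 : position (b ^- n * (c * b ^+ n)) = (n%:R * tau w + position c)%R.
    by rewrite -[_ * _]/(c ^ (b ^+ n)) cn positionMr // discrete_dil // mul1r tn.
  move: p5 p6; rewrite mulVg position1 => p5 p6.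
  by rewrite ler_norml; apply/andP; split; lra.
have w1 : (0 < `|tau w|)%R by rewrite normr_gt0.
pose n := Num.bound (3 * tau t / `|tau w|)%R.
have := bound n; rewrite normrM normr_nat -ler_pdivlMr // leNgt.
by rewrite archi_boundP //; apply: divr_ge0; [apply: mulr_ge0 => //|]; exact: ltW.
Qed.

(** The increment of [position] under left multiplication by [g] depends only on
    the coset of [A], and left multiplication permutes the cosets. Summing the
    increments over the cosets therefore turns the quasimorphism into a
    homomorphism; this is the transfer. *)
Lemma discrete_average : fin_index D A ->
  exists beta : G -> R, [/\ is_hom D beta, 
    forall x, D x -> (0 < beta x)%R -> r 1 x & exists2 v, D v & beta v != 0%R].
Proof.
move=> fA.
pose T := [set lcoset x A | x in D].
have finT : finite_set T.
  have [s sP] := fA.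
  apply: (@sub_finite_set _ _ [set lcoset x A | x in [set` s]]); last first.
    exact/finite_image/finite_seq.
  move=> _ [x Dx <-]; have [u us Au] := sP _ Dx.
  exists u => //; apply/seteqP; split=> y [a Aa <-].
    exists ((u^-1 * x)^-1 * a); first by apply: AM => //; exact: sgV.
    by rewrite invgM invgK !mulgA mulgV mul1g.
  by exists (u^-1 * x * a); [exact: AM|rewrite !mulgA mulgV mul1g].
pose rep (c : set G) := xget 1 c.
have repP c : T c -> exists2 x, D x & c = lcoset x A /\ exists2 a, A a & rep c = x * a.
  move=> [x Dx <-]; exists x => //; split=> //.
  have : lcoset x A (rep (lcoset x A)).
    by apply: (@xgetI _ _ _ (x * 1)); exists 1 => //; exact: sg1.
  by move=> [a Aa <-]; exists a.
have repD c : T c -> D (rep c).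
  by move=> /repP[x Dx [_ [a Aa ->]]]; apply: DM => //; exact: AD.
pose F g x : R := (position (g * x) - position x)%R.
have Fcoset g x a : D g -> D x -> A a -> F g (x * a) = F g x.
  move=> Dg Dx Aa; have Dgx := DM Dg Dx.
  by rewrite /F mulgA (positionMr Aa Dgx) (positionMr Aa Dx) !discrete_dil // !mul1r; lra.
have Frep g x : D g -> D x -> F g (rep (lcoset x A)) = F g x.
  move=> Dg Dx; have : lcoset x A (rep (lcoset x A)).
    by apply: (@xgetI _ _ _ (x * 1)); exists 1 => //; exact: sg1.
  by move=> [a Aa <-]; exact: Fcoset.
pose beta g : R := (\sum_(c \in T) F g (rep c))%R.
have betaM : is_hom D beta.
  move=> g h Dg Dh.
  have bij : set_bij T T (fun c => [set h * y | y in c]).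
    have act x : [set h * y | y in lcoset x A] = lcoset (h * x) A.
      apply/seteqP; split=> y.
        by move=> [_ [a Aa <-] <-]; exists a; rewrite ?mulgA.
      by move=> [a Aa <-]; exists (x * a); rewrite ?mulgA //; exists a.
    split.
    - by move=> _ [x Dx <-] /=; exists (h * x); [exact: DM|rewrite act].
    - move=> c c' _ _ /= e; apply/seteqP; split=> y cy.
        have : [set h * y | y in c] (h * y) by exists y.
        by rewrite e => -[z cz /mulgI <-].
      have : [set h * y | y in c'] (h * y) by exists y.
      by rewrite -e => -[z cz /mulgI <-].
    - move=> _ [x Dx <-]; exists (lcoset (h^-1 * x) A).
        by exists (h^-1 * x) => //; apply: DM => //; exact: DV.
      by rewrite act mulVKg.
  rewrite {2}/beta (reindex_fsbig _ _ _ _ bij) /beta -fsbig_split //=.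
  apply: eq_fsbigr => c; rewrite inE => Tc.
  have [x Dx [cE _]] := repP _ Tc.
  have -> : [set h * y | y in c] = lcoset (h * rep c) A.
    have [x' Dx' [cE' [a Aa ->]]] := repP _ Tc.
    rewrite cE'; apply/seteqP; split=> y.
      move=> [_ [b Ab <-] <-]; exists (a^-1 * b).
        by apply: AM => //; exact: sgV.
      by rewrite !mulgA mulgK.
    by move=> [b Ab <-]; exists (x' * (a * b)); [exists (a * b) => //; exact: AM|rewrite !mulgA].
  rewrite Frep //; last by apply: DM => //; exact: repD.
  by rewrite /F !mulgA; lra.
have T1 : T (lcoset 1 A) by exists 1 => //; exact: sg1.
have betaA a : A a -> beta a = (\sum_(c \in T) tau a)%R.
  move=> Aa; apply: eq_fsbigr => c; rewrite inE => Tc.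
  by rewrite /F positionMl ?addrK //; exact: repD.
have sum_tau a : (\sum_(c \in T) tau a)%R = ((#|` fset_set T|)%:R * tau a)%R.
  by rewrite fsbig_finite //= big_const_seq count_predT iter_addr_0 mulr_natl.
have N0 : (0 < (#|` fset_set T|)%:R :> R)%R.
  rewrite ltr0n cardfs_gt0; apply/fset0Pn; exists (lcoset 1 A).
  by rewrite in_fset_set // inE.
exists beta; split=> //.
  move=> x Dx x0; have [m m0 Am] := fin_index_torsion sD sA fA Dx.
  have : (0 < beta (x ^+ m)%g)%R.
    by rewrite (homX sD betaM) // pmulrn_lgt0.
  rewrite betaA // sum_tau pmulr_rgt0 // => /tauP-/(_ Am) [xm nBm].
  have [//|x1] := lo_tot r x.
  case: nBm; rewrite (lo_anti1 xm); first by case: cB => /sg1.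
  by rewrite -expVgn; exact: lo_geX.
exists a0; first exact: AD.
by rewrite betaA // sum_tau mulf_neq0 // gt_eqF.
Qed.

End Discrete.

End Translation.

(** * Orders come from affine actions *)

Section Affine.
Context {R : realType} {G : groupType} (r : left_ordering G).

(** [g] acts on the line as the map sending [t] to [lam g * t + beta g], and the
    order looks at the image of [0]. *)
Record affine (D : set G) (lam beta : G -> R) : Prop := Affine {
  affine_gt0 : forall x, D x -> (0 < lam x)%R;
  affine_lamM : forall x y, D x -> D y -> lam (x * y) = (lam x * lam y)%R;
  affine_betaM : forall x y, D x -> D y -> beta (x * y) = (beta x + lam x * beta y)%R;
  affine_order : forall x, D x -> (0 < beta x)%R -> r 1 x;
  affine_translation : exists v, [/\ D v, lam v = 1%R & beta v != 0%R] }.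

(** Let [C] be the largest proper convex subgroup of [D], and let [A] be the
    first term of the chain, intersected with [D], that is abelian modulo [C]. If
    the translation numbers of [A] are dense, then [position] is a cocycle. If they
    are discrete, then [discrete_commutator] shows that a preceding term would be
    abelian modulo [C] as well, so the chain starts at [A]; then [A] has finite
    index in [D], and the averaged position is a homomorphism. *)
Theorem affine_action n (D : set G) (N : nat -> set G) :
  hirsch n D -> solvable_chain N -> proper D [set 1] ->
  exists lam beta, affine D lam beta.
Proof.
move=> hD [sN nrmN fN cN [k Nk]] pD; have sD := hirsch_subgroup hD.
have [C mC] := max_convex_exists r sD (hirsch_fgen hD) pD.
have [cC [d Dd nCd] _] := mC; have [sC _ _] := cC.
pose abelian i := forall x y, N i x -> D x -> N i y -> D y -> C [~ x, y].
have ex : exists i, `[< abelian i >].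
  exists k; apply/asboolP => x y /Nk -> _ _ _.
  by rewrite comm1g; exact: sg1.
case: (ex_minnP ex) => i /asboolP abi imin.
pose A := N i `&` D.
have sA : subgroup A by exact: subgroupI.
have AD : A `<=` D by exact: subIsetr.
have nA : normal_in D A.
  by move=> x y Dx [Ny Dy]; split; [exact: nrmN|exact: sgJ].
(* by minimality of [i], the chain starts at [A] or the preceding term is not
   abelian modulo [C] *)
have dich : fin_index D A \/ exists x y, [/\ D x, D y, A [~ x, y] & ~ C [~ x, y]].
  have [i0|[j ij]] : i = 0%N \/ exists j, i = j.+1.
    by case: (i) => [|j]; [left|right; exists j].
    by left; rewrite /A i0; exact: (fin_index_sub (sN 0%N) sD (@subsetT _ D) fN).
  right; apply: contrapT => nex.
  have /imin : `[< abelian j >]; last by rewrite ij ltnn.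
  apply/asboolP => x y Nx Dx Ny Dy; apply: contrapT => nC; apply: nex.
  exists x, y; split=> //; rewrite /A ij; split; [exact: cN|exact: sgR].
have nAC : ~ A `<=` C.
  move=> subAC; case: dich => [fA|[x [y [_ _ /subAC]]] //].
  by apply: nCd; apply: (convex_fin_index sD cC (fin_indexS subAC fA)).
have abA x y : A x -> A y -> C [~ x, y] by move=> [Nx Dx] [Ny Dy]; exact: abi.
have fgA : fgen A by have [m /hirsch_fgen] := hirsch_le hD sA AD.
have [B [tau [cB htau [a0 Aa0 ta0] tauP]]] :=
  translation_number (R := R) mC sA AD nAC abA fgA.
have [dense|/existsNP[e /not_implyP[e0 nex]]] := pselect (forall e : R, (0 < e)%R ->
    exists a, [/\ A a, (0 < tau a)%R & (tau a < e)%R]).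
  exists (dil tau a0), (position r A tau); split.
  - exact: (dil_gt0 sD mC sA AD nA nAC cB htau Aa0 ta0 tauP).
  - exact: (dilM sD mC sA AD nA nAC cB htau Aa0 ta0 tauP).
  - exact: (position_cocycle sD mC sA AD nA nAC cB htau Aa0 ta0 tauP).
  - exact: (position_gt0 sD mC sA AD nA nAC cB htau tauP).
  - exists a0; split; first exact: AD.
      exact: (dilA sA htau Aa0 ta0 Aa0).
    by rewrite (positionA sD mC sA AD nA nAC cB htau tauP) // gt_eqF.
have eP a : A a -> (0 < tau a)%R -> (e <= tau a)%R.
  by move=> Aa a0'; rewrite leNgt; apply/negP => lt; apply: nex; exists a.
have [t [At t0 tmin]] := tau_discrete sA htau Aa0 ta0 e0 eP.
have [fA|[x [y [Dx Dy Axy []]]]] := dich; last first.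
  exact: (discrete_commutator sD mC sA AD nA nAC cB htau Aa0 ta0 tauP At t0 tmin).
have [beta [hbeta bpos [v Dv v0]]] :=
  discrete_average sD mC sA AD nA nAC cB htau Aa0 ta0 tauP At t0 tmin fA.
exists (fun=> 1%R), beta; split=> //.
- by move=> x y _ _; rewrite mulr1.
- by move=> x y Dx Dy; rewrite mul1r hbeta.
- by exists v.
Qed.

Context (D : set G) (sD : subgroup D) (lam beta : G -> R) (af : affine D lam beta).

Lemma affine_lam1 : lam 1 = 1%R.
Proof.
have D1 := sg1 sD; have /eqP := affine_lamM af D1 D1.
by rewrite mulg1 -subr_eq0 -{1}(mulr1 (lam 1)) -mulrBr mulf_eq0 gt_eqF ?(affine_gt0 af) //=
  subr_eq0 => /eqP.
Qed.

Lemma affine_beta1 : beta 1 = 0%R.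
Proof.
have D1 := sg1 sD; have := affine_betaM af D1 D1.
by rewrite mulg1 affine_lam1; lra.
Qed.

Lemma affine_lamV x : D x -> (lam x * lam x^-1)%R = 1%R.
Proof.
by move=> Dx; rewrite -(affine_lamM af) ?mulgV ?affine_lam1 //; exact: sgV.
Qed.

Lemma affine_betaV x : D x -> beta x^-1 = (- (lam x^-1 * beta x))%R.
Proof.
move=> Dx; have DVx := sgV sD Dx; have := affine_betaM af DVx Dx.
by rewrite mulVg affine_beta1; lra.
Qed.

Definition affine_stab := [set x | D x /\ beta x = 0%R].

Lemma affine_le x : D x -> r 1 x -> (0 <= beta x)%R.
Proof.
move=> Dx x1; rewrite leNgt; apply/negP => neg.
have DVx := sgV sD Dx.
have x2 : r 1 x^-1.
  apply: (affine_order af) => //; rewrite affine_betaV // oppr_gt0.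
  by rewrite pmulr_rlt0 // (affine_gt0 af).
by move: neg; rewrite (lo_anti1 x1 x2) affine_beta1 ltxx.
Qed.

Lemma affine_stab_convex : convex r D affine_stab.
Proof.
split; last 2 first.
- by move=> x [].
- move=> x y [Dx x0] Dy y1 yx; split=> //; apply/eqP.
  rewrite eq_le affine_le // andbT.
  have DVy := sgV sD Dy.
  have := affine_le (sgM sD DVy Dx); rewrite -lo_div => /(_ yx).
  rewrite (affine_betaM af) // x0 mulr0 addr0 affine_betaV //.
  by rewrite oppr_ge0 pmulr_rle0 // (affine_gt0 af).
split=> [|x y [Dx x0] [Dy y0]|x [Dx x0]].
- by split; [exact: sg1|exact: affine_beta1].
- by split; [exact: sgM|rewrite (affine_betaM af) // x0 y0 mulr0 addr0].
- by split; [exact: sgV|rewrite affine_betaV // x0 mulr0 oppr0].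
Qed.

Lemma affine_stab_proper : proper D affine_stab.
Proof.
by have [v [Dv _ /eqP v0]] := affine_translation af; exists v => // -[].
Qed.

End Affine.

(** * Perturbing an isolated order *)

Section OrderChange.
Context {G : groupType} (r : left_ordering G).
Implicit Types (x y : G) (D Q : set G).

Definition isolated_by (F : {fset G}) :=
  forall s : left_ordering G, lo_base F s -> s = r.

(** Positive cones contain the identity here. *)
Record cone D Q : Prop := Cone {
  cone_anti : forall x, D x -> Q x -> Q x^-1 -> x = 1;
  cone_total : forall x, D x -> Q x \/ Q x^-1;
  coneM : forall x y, D x -> D y -> Q x -> Q y -> Q (x * y) }.

(** Outside [D] signs are kept and inside [D] they are read from [Q]. The convexity
    of [D] makes this a left-ordering: multiplying by an element of [D] does not
    change the sign of an element outside [D]. *)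
Lemma order_change F D Q : lo_base F r -> isolated_by F -> convex r [set: G] D -> cone D Q ->
  (forall u, u \in F -> D u -> Q u) -> forall x, D x -> r 1 x -> Q x.
Proof.
move=> Fr iso cD cQ FQ; have [sD _ co] := cD.
pose S x := (r 1 x /\ ~ D x) \/ (D x /\ Q x).
have D1 := sg1 sD.
have S1 : S 1.
  by right; split=> //; case: (cone_total cQ D1) => //; rewrite invg1.
have mixed x y : D x -> above r D y -> above r D (x * y).
  move=> Dx [y1 nDy]; split; last by move=> /(sgMr sD Dx).
  have /orP[xy|xy] := lo_total r x^-1 y; first by move: xy; rewrite lo_div invgK.
  by case: nDy; apply: (co x^-1) => //; exact: sgV.
have SM x y : S x -> S y -> S (x * y).
  move=> [[x1 nDx]|[Dx Qx]] [[y1 nDy]|[Dy Qy]].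
  - left; split; first exact: lo_geM.
    by move=> Dxy; apply: nDx; apply: (co (x * y)) => //; rewrite lo_div mulKg.
  - by left; apply: (above_mulC subgroup_setT cD).
  - by left; exact: mixed.
  - by right; split; [exact: sgM|exact: (coneM cQ)].
pose le x y := `[< S (x^-1 * y) >].
have le_total : total le.
  move=> x y; apply/orP.
  have e : y^-1 * x = (x^-1 * y)^-1 by rewrite invgM invgK.
  rewrite /le e; set z := x^-1 * y.
  have [Dz|nDz] := pselect (D z).
    case: (cone_total cQ Dz) => q; [left|right]; apply/asboolP; right; split=> //.
    exact: sgV.
  have [z1|z1] := lo_tot r z; [left|right]; apply/asboolP; left; split=> //.
  by move=> /(sgVr sD).
have le_anti : antisymmetric le.
  move=> x y /andP[/asboolP Sz /asboolP].
  have -> : y^-1 * x = (x^-1 * y)^-1 by rewrite invgM invgK.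
  move: Sz; set z := x^-1 * y => Sz Sz'.
  suff : z = 1 by rewrite /z => /(congr1 (fun u => x * u)); rewrite mulVKg mulg1.
  case: Sz Sz' => [[z1 nDz]|[Dz Qz]] [[z2 nDz']|[Dz' Qz']].
  - exact: lo_anti1 z1 z2.
  - by case: nDz; exact: sgVr Dz'.
  - by case: nDz'; exact: sgV.
  - exact: (cone_anti cQ Dz Qz).
have le_trans : transitive le.
  move=> y x z /asboolP xy /asboolP yz; apply/asboolP.
  by have := SM _ _ xy yz; rewrite mulgA mulgK.
have le_mul f g h : le f g -> le (h * f) (h * g).
  by move=> /asboolP fg; apply/asboolP; rewrite invgM mulgA mulgVK.
pose s := LeftOrdering le_total le_anti le_trans le_mul.
have sr : s = r.
  apply: iso => u uF; apply/asboolP; rewrite invg1 mul1g.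
  have [Du|nDu] := pselect (D u); first by right; split=> //; exact: FQ.
  by left; split=> //; exact: Fr.
move=> x Dx; rewrite -sr => /asboolP; rewrite invg1 mul1g.
by case=> [[_ nDx]|[]].
Qed.

Context {R : realType}.

(** The set where [f] is positive, completed by the given order where [f]
    vanishes, is another positive cone on [D] that contains [F]; it must be the
    cone of [r]. *)
Lemma cocycle_perturb F D (lam f : G -> R) : lo_base F r -> isolated_by F ->
  convex r [set: G] D ->
  (forall x, D x -> (0 < lam x)%R) ->
  (forall x y, D x -> D y -> f (x * y) = (f x + lam x * f y)%R) ->
  (forall u, u \in F -> D u -> (0 <= f u)%R) ->
  forall x, D x -> r 1 x -> (0 <= f x)%R.
Proof.
move=> Fr iso cD lam0 fM Ff; have [sD _ _] := cD.
pose Q x := (0 < f x)%R \/ (f x = 0%R /\ r 1 x).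
have f1 : f 1 = 0%R.
  have D1 := sg1 sD; have := fM _ _ D1 D1; rewrite mulg1.
  by have := lam0 _ D1; nra.
have fV y : D y -> (f y + lam y * f (y^-1)%g = 0)%R.
  by move=> Dy; rewrite -fM ?mulgV //; exact: sgV.
have fV0 y : D y -> ((0 < f (y^-1)%g) = (f y < 0))%R.
  move=> Dy; have := fV y Dy; have := lam0 y Dy; case: ltrgtP; nra.
have fV1 y : D y -> f y = 0%R -> f (y^-1) = 0%R.
  move=> Dy y0; have := fV y Dy; rewrite y0 add0r => /eqP.
  by rewrite mulf_eq0 gt_eqF ?lam0 //= => /eqP.
suff cQ : cone D Q.
  move=> x Dx x1.
  suff : Q x by move=> [/ltW//|[-> _]].
  apply: (order_change Fr iso cD cQ) => // u uF Du.
  have := Ff _ uF Du; rewrite le_eqVlt => /predU1P[u0|]; last by left.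
  by right; split=> //; exact: Fr.
split.
- move=> y Dy [y0|[y0 y1]]; rewrite /Q fV0 //.
    by rewrite ltNge ltW // => -[//|[y0' _]]; have := fV y Dy; rewrite y0' mulr0 addr0 => e;
      rewrite e ltxx in y0.
  by rewrite y0 ltxx => -[//|[_ y1']]; exact: lo_anti1 y1 y1'.
- move=> y Dy; rewrite /Q fV0 //.
  have [y0|y0|y0] := ltgtP (f y) 0%R; [by right; left|by left; left|].
  by have [y1|y1] := lo_tot r y; [left|right]; right; split=> //; exact: fV1.
- move=> y z Dy Dz Qy Qz; rewrite /Q fM //; have ly := lam0 y Dy.
  case: Qy => [y0|[y0 y1]]; case: Qz => [z0|[z0 z1]].
  + by left; rewrite addr_gt0 // mulr_gt0.
  + by left; rewrite z0 mulr0 addr0.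
  + by left; rewrite y0 add0r mulr_gt0.
  + by right; split; [rewrite y0 z0 mulr0 addr0|exact: lo_geM].
Qed.

(** Only finitely many positive values of [a] have to absorb [e * b]. *)
Lemma small_eps (s : seq G) (P : G -> Prop) (a b : G -> R) :
  (forall u, u \in s -> P u -> (0 <= a u)%R) ->
  (forall u, u \in s -> P u -> a u = 0%R -> (0 <= b u)%R) ->
  exists2 e : R, (0 < e)%R & forall u, u \in s -> P u -> (0 <= a u + e * b u)%R.
Proof.
move=> a0 b0.
suff [e e0 eP] : exists2 e : R, (0 < e)%R & forall d : R, (0 < d)%R -> (d <= e)%R ->
    forall u, u \in s -> P u -> (0 <= a u + d * b u)%R by exists e => //; exact: eP.
elim: s a0 b0 => [|w s IH] a0 b0; first by exists 1%R.
have [||e e0 eP] := IH.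
- by move=> u us; apply: a0; rewrite inE us orbT.
- by move=> u us; apply: b0; rewrite inE us orbT.
have {a0}aw : P w -> (0 <= a w)%R by apply: a0; rewrite mem_head.
have {b0}bw : P w -> a w = 0%R -> (0 <= b w)%R by apply: b0; rewrite mem_head.
have [e' e'0 e'P] : exists2 e' : R, (0 < e')%R & forall d : R, (0 < d)%R -> (d <= e')%R ->
    P w -> (0 <= a w + d * b w)%R.
  have [Pw|nPw] := pselect (P w); last by exists 1%R.
  have := aw Pw; rewrite le_eqVlt => /predU1P[/esym/[dup] aw0 /(bw Pw) bw0|aw0].
    by exists 1%R => // d d0 _ _; rewrite aw0 add0r mulr_ge0 // ltW.
  have nb : (0 < 1 + `|b w|)%R by have := normr_ge0 (b w); lra.
  exists (a w / (1 + `|b w|))%R; first by rewrite divr_gt0.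
  move=> d d0; rewrite ler_pdivlMr // => h _.
  have := ler_norm (- b w)%R; rewrite normrN; have := normr_ge0 (b w); nra.
exists (Num.min e e'); first by rewrite lt_min e0.
move=> d d0; rewrite le_min => /andP[de de'] u; rewrite inE => /predU1P[->|us].
  exact: e'P.
exact: eP.
Qed.

Lemma bernoulli (h : R) n : (0 <= h)%R -> (1 + n%:R * h <= (1 + h) ^+ n)%R.
Proof.
move=> h0; elim: n => [|n IH]; first by rewrite mul0r addr0 expr0.
rewrite exprS -natr1; have : (0 <= n%:R :> R)%R by [].
nra.
Qed.

Lemma exp_small (q d : R) : (0 < q)%R -> (q < 1)%R -> (0 < d)%R -> exists n, (q ^+ n < d)%R.
Proof.
move=> q0 q1 d0; pose h := (q^-1 - 1)%R.
have h0 : (0 < h)%R by rewrite subr_gt0 invf_gt1.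
pose n := Num.bound (d^-1 / h)%R; exists n.
have hn := bernoulli n (ltW h0); rewrite (_ : 1 + h = q^-1)%R in hn; last by rewrite /h; lra.
have : (d^-1 < n%:R * h)%R.
  by rewrite -ltr_pdivrMr //; apply: archi_boundP; rewrite divr_ge0 ?invr_ge0 // ltW.
move=> dn; have : (d^-1 < q^-1 ^+ n)%R by apply: lt_le_trans hn; lra.
by rewrite exprVn ltf_pV2 // posrE ?exprn_gt0.
Qed.

End OrderChange.

(** * Homomorphisms on convex subgroups of an isolated order *)

Section Dilation.
Context {R : realType} {G : groupType} (r : left_ordering G).
Context (D : set G) (sD : subgroup D) (lam beta : G -> R) (af : affine r D lam beta).

Let lamX x n : D x -> lam (x ^+ n) = (lam x ^+ n)%R.
Proof.
move=> Dx; elim: n => [|n IH]; first by rewrite (affine_lam1 sD af).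
by rewrite expgS (affine_lamM af) ?IH ?exprS //; exact: sgX.
Qed.

(** A contraction conjugates a translation to arbitrarily short ones. *)
Lemma short_translation u (e : R) : D u -> lam u != 1%R -> (0 < e)%R ->
  exists y, [/\ D y, lam y = 1%R, (0 < beta y)%R & (beta y < e)%R].
Proof.
move=> Du u1 e0.
have {u Du u1} [w [Dw w0 w1]] : exists w, [/\ D w, (0 < lam w)%R & (lam w < 1)%R].
  have [ul|ul|/eqP] := ltgtP (lam u) 1%R; last by rewrite (negbTE u1).
    by exists u; split=> //; exact: (affine_gt0 af).
  have DVu := sgV sD Du; exists u^-1; split=> //; first exact: (affine_gt0 af).
  have := affine_lamV sD af Du; have := affine_gt0 af DVu; nra.
have [v [Dv v1 v0]] : exists v, [/\ D v, lam v = 1%R & (0 < beta v)%R].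
  have [v [Dv v1 v0]] := affine_translation af.
  have [vn|vp|/eqP] := ltgtP (beta v) 0%R; last by rewrite (negbTE v0).
    have lV : lam v^-1 = 1%R by have := affine_lamV sD af Dv; rewrite v1 mul1r.
    exists v^-1; split=> //; first exact: sgV.
    by rewrite (affine_betaV sD af) // lV mul1r oppr_gt0.
  by exists v.
have [n nlt] := exp_small w0 w1 (divr_gt0 e0 v0).
have Dn := sgX n sD Dw; have DVn := sgV sD Dn.
exists (w ^+ n * (v * w ^- n)).
have bE : beta (w ^+ n * (v * w ^- n)) = (lam w ^+ n * beta v)%R.
  rewrite !(affine_betaM af) //; last exact: sgM.
  rewrite v1 (affine_betaV sD af) // mul1r mulrDr mulrN mulrA (affine_lamV sD af Dn).
  by rewrite lamX // mul1r; lra.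
split.
- by do !apply: sgM.
- rewrite !(affine_lamM af) //; last exact: sgM.
  by rewrite v1 mul1r (affine_lamV sD af).
- by rewrite bE mulr_gt0 // exprn_gt0.
- by rewrite bE -ltr_pdivlMr.
Qed.

(** The order given by the image of [c] differs from the one given by the image
    of [0]. The witness is a strong contraction or dilation, corrected by a short
    translation so that it moves [0] up by very little. *)
Lemma base_point_moves u (c : R) : D u -> lam u != 1%R -> c != 0%R ->
  exists g, [/\ D g, (0 < beta g)%R & (beta g + (lam g - 1) * c < 0)%R].
Proof.
move=> Du u1 c0; have Pc : (0 < `|c|)%R by rewrite normr_gt0.
have [w [Dw wc]] : exists w, D w /\ ((lam w - 1) * c <= - (`|c| / 2))%R.
  have small : exists w, [/\ D w, (0 < lam w)%R & (lam w < 1 / 2)%R].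
    have [w [Dw w0 w1]] : exists w, [/\ D w, (0 < lam w)%R & (lam w < 1)%R].
      have [ul|ul|/eqP] := ltgtP (lam u) 1%R; last by rewrite (negbTE u1).
        by exists u; split=> //; exact: (affine_gt0 af).
      have DVu := sgV sD Du; exists u^-1; split=> //; first exact: (affine_gt0 af).
      have := affine_lamV sD af Du; have := affine_gt0 af DVu; nra.
    have [|n nlt] := exp_small w0 w1 (d := 1 / 2); first by lra.
    exists (w ^+ n); split; [exact: sgX| |by rewrite lamX].
    by rewrite lamX // exprn_gt0.
  have [w [Dw w0 w1]] := small.
  have [cn|cp|/eqP] := ltgtP c 0%R; last by rewrite (negbTE c0).
    exists w^-1; split; first exact: sgV.
    have := affine_lamV sD af Dw; have := affine_gt0 af (sgV sD Dw).
    by rewrite ltr0_norm //; nra.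
  by exists w; split=> //; rewrite gtr0_norm //; nra.
have [|y [Dy y1 y0 ye]] := short_translation (e := `|c| / 2) Du u1; first by rewrite divr_gt0.
pose k := (Num.floor (- beta w / beta y) + 1)%R.
have lZ z : D z -> lam z = 1%R -> forall m : nat,
    lam (z ^+ m) = 1%R /\ beta (z ^+ m) = (m%:R * beta z)%R.
  move=> Dz z1; elim=> [|m [lm bm]].
    by rewrite (affine_lam1 sD af) (affine_beta1 sD af) mul0r.
  have Dm := sgX m sD Dz.
  rewrite expgS (affine_lamM af) // (affine_betaM af) // z1 lm bm -natr1.
  by split; lra.
have [lk bk] : lam (zpow y k) = 1%R /\ beta (zpow y k) = (k%:~R * beta y)%R.
  case: k => m; first exact: lZ.
  have [lm bm] := lZ _ Dy y1 m.+1; have Dm := sgX m.+1 sD Dy.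
  have lV : lam (y ^- m.+1) = 1%R by have := affine_lamV sD af Dm; rewrite lm mul1r.
  by rewrite /= lV (affine_betaV sD af) // lV bm NegzE mulrNz; split => //; rewrite mul1r mulNr.
have k1 : (0 < beta w + k%:~R * beta y)%R.
  have := floorD1_gt (- beta w / beta y)%R; rewrite -/k ltr_pdivrMr //; lra.
have k2 : (beta w + k%:~R * beta y <= beta y)%R.
  have := floor_le (- beta w / beta y)%R; rewrite ler_pdivlMr // /k intrD; lra.
have Dk := sgZ k sD Dy.
exists (zpow y k * w); split; first exact: sgM.
  by rewrite (affine_betaM af) // lk bk; lra.
by rewrite (affine_betaM af) // (affine_lamM af) // lk bk; lra.
Qed.

End Dilation.

Section Isolated.
Context {R : realType} {G : groupType} (r : left_ordering G) (F : {fset G}).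
Hypotheses (Fr : lo_base F r) (iso : isolated_by r F).
Context (N : nat -> set G) (chain : solvable_chain N).

Lemma convex_trans (D E C : set G) : convex r D E -> convex r E C -> convex r D C.
Proof.
move=> [sE ED cE] [sC CE cC]; split=> //; first exact: subset_trans ED.
by move=> x y Cx Dy y1 yx; apply: (cC x) => //; apply: (cE x) => //; exact: CE.
Qed.

Lemma properPn (D : set G) : ~ proper D [set 1] -> forall x, D x -> x = 1.
Proof. by move=> nD x Dx; apply: contrapT => x1; apply: nD; exists x. Qed.

(** What isolation imposes on a nontrivial convex subgroup: up to scaling there
    is one homomorphism to the reals, and it respects the order. *)
Record unique_hom (D : set G) (beta : G -> R) : Prop := UniqueHom {
  uh_hom : is_hom D beta;
  uh_nz : exists2 v, D v & beta v != 0%R;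
  uh_pos : forall x, D x -> r 1 x -> (0 <= beta x)%R;
  uh_convex : convex r D [set x | D x /\ beta x = 0%R];
  uh_unique : forall phi : G -> R, is_hom D phi ->
    exists c : R, forall x, D x -> phi x = (c * beta x)%R }.

(** This is the form in which the induction hypothesis is used: a homomorphism
    that is a multiple of a monotone one is monotone up to sign. *)
Lemma unique_hom_sign (D : set G) (phi : G -> R) : subgroup D ->
  (proper D [set 1] -> exists beta, unique_hom D beta) -> is_hom D phi ->
  exists2 s : R, s != 0%R & forall x, D x -> r 1 x -> (0 <= s * phi x)%R.
Proof.
move=> sD H hphi; have [/H[beta uh]|nD] := pselect (proper D [set 1]); last first.
  exists 1%R; first exact: oner_neq0.
  by move=> x /(properPn nD) -> _; rewrite (hom1 sD hphi) mulr0.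
have [c cE] := uh_unique uh hphi.
have [c0|c0] := eqVneq c 0%R.
  exists 1%R; first exact: oner_neq0.
  by move=> x Dx _; rewrite cE // c0 mul0r mulr0.
exists c => // x Dx x1; rewrite cE // mulrA mulr_ge0 //; last exact: (uh_pos uh).
by rewrite -expr2 sqr_ge0.
Qed.

(** By induction on the rank, every homomorphism on the stabilizer [C] of the
    origin is monotone up to sign. If [lam] were not trivial, the base point [0]
    could be moved slightly, in the direction that the sign of [ln lam] on [C]
    dictates, without making an element of [F] negative, and this would change the
    order. So [lam] is trivial and [beta] is a homomorphism. For another homomorphism
    [phi], the order is likewise unchanged when a small multiple of [phi], with the
    sign that suits [C], is added to [beta]; hence the sum is proportional to
    [beta], and so is [phi]. *)
Theorem isolated_unique_hom n (D : set G) : hirsch n D -> convex r [set: G] D ->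
  proper D [set 1] -> exists beta, unique_hom D beta.
Proof.
elim/ltn_ind: n D => n IH D hD cD pD; have sD := hirsch_subgroup hD.
have [lam [beta af]] := affine_action (R := R) r hD chain pD.
pose C := affine_stab D beta.
have cDC : convex r D C := affine_stab_convex sD af.
have cC : convex r [set: G] C := convex_trans cD cDC.
have [sC CD _] := cDC.
have [m mn hC] : exists2 m, (m < n)%N & hirsch m C.
  have [//|[_ fC]] := hirsch_sub hD sC CD.
  have [d Dd] := affine_stab_proper af; case.
  exact: (convex_fin_index sD cDC fC).
have signC (phi : G -> R) := @unique_hom_sign C phi sC (IH m mn C hC cC).
have le0 := affine_le sD af.
have lam1 x : D x -> lam x = 1%R.
  move=> Dx; apply/eqP; apply: contrapT => /negP x1.
  have hln : is_hom C (fun x => ln (lam x)).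
    move=> y z /CD Dy /CD Dz.
    by rewrite (affine_lamM af) // lnM // posrE (affine_gt0 af).
  have [s s0 sP] := signC _ hln.
  have sP' u : C u -> r 1 u -> (0 <= s * (lam u - 1))%R.
    move=> Cu u1; have := sP u Cu u1; have lu := affine_gt0 af (CD _ Cu).
    have [l|l|->] := ltgtP (lam u) 1%R; last by rewrite subrr mulr0.
    - by have := ln_lt0 (x := lam u); rewrite lu l => /(_ isT); nra.
    - by have := ln_gt0 l; nra.
  have [e e0 eP] := @small_eps _ R F D beta (fun u => s * (lam u - 1))%R
    (fun u uF Du => le0 u Du (Fr uF)) (fun u uF Du u0 => sP' u (conj Du u0) (Fr uF)).
  pose f u := (beta u + e * (s * (lam u - 1)))%R.
  have fpos := @cocycle_perturb _ r R F D lam f Fr iso cD (affine_gt0 af).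
  have {}fpos : forall x, D x -> r 1 x -> (0 <= f x)%R.
    apply: fpos => // y z Dy Dz.
    by rewrite /f (affine_betaM af) // (affine_lamM af) //; lra.
  have [|g [Dg g0 gneg]] := base_point_moves sD af (c := (e * s)%R) Dx x1.
    by rewrite mulf_neq0 // gt_eqF.
  have := fpos g Dg (affine_order af Dg g0); rewrite /f; lra.
have hbeta : is_hom D beta.
  by move=> x y Dx Dy; rewrite (affine_betaM af) // lam1 // mul1r.
have bnz : exists2 v, D v & beta v != 0%R.
  by have [v [Dv _ v0]] := affine_translation af; exists v.
exists beta; split=> // phi hphi.
have [s s0 sP] := signC _ (is_homS CD hphi).
have [e e0 eP] := @small_eps _ R F D beta (fun u => s * phi u)%R
  (fun u uF Du => le0 u Du (Fr uF)) (fun u uF Du u0 => sP u (conj Du u0) (Fr uF)).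
pose f u := (beta u + e * (s * phi u))%R.
have hf : is_hom D f.
  by move=> x y Dx Dy; rewrite /f hbeta // hphi //; lra.
have fpos : forall x, D x -> r 1 x -> (0 <= f x)%R.
  apply: (@cocycle_perturb _ r R F D (fun=> 1%R) f Fr iso cD) => //.
  by move=> x y Dx Dy; rewrite mul1r hf.
have [|k _ kP] := hom_proportional sD hbeta hf _ bnz.
  by move=> x Dx x0; apply: fpos => //; exact: (affine_order af).
exists ((k - 1) / (e * s))%R => x Dx.
have es : (e * s)%R != 0%R by rewrite mulf_neq0 // gt_eqF.
apply: (mulfI es); rewrite mulrA mulrCA divff // mulr1.
by have := kP x Dx; rewrite /f; lra.
Qed.

End Isolated.

(** * The sign series of an isolated order *)

Section Span.
Context {R : realType}.
Implicit Types (s : seq R) (x y b : R).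

Fixpoint span s : set R :=
  if s is b :: s' then [set x | exists n : int, span s' (x - n%:~R * b)%R] else [set 0%R].

Lemma span0 s : span s 0%R.
Proof. by elim: s => [//|b s IH]; exists 0%R; rewrite mul0r subr0. Qed.

Lemma spanB s x y : span s x -> span s y -> span s (x - y)%R.
Proof.
elim: s x y => [x y -> ->|b s IH x y [n nx] [m my]]; first by rewrite subr0.
exists (n - m)%R; rewrite intrD mulrNz mulrBl.
by have := IH _ _ nx my; congr (span s _); lra.
Qed.

Lemma spanD s x y : span s x -> span s y -> span s (x + y)%R.
Proof.
by move=> sx sy; rewrite -(opprK y) -(sub0r y); do 2!apply: spanB => //; exact: span0.
Qed.

Lemma spanZ s x (n : int) : span s x -> span s (n%:~R * x)%R.
Proof.
move=> sx; elim/int_rect: n => [|n IH|n IH]; first by rewrite mul0r; exact: span0.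
- by rewrite -addn1 PoszD intrD mulrDl mul1r; exact: spanD.
- rewrite (_ : (- n.+1%:Z = - n%:Z - 1)%R); last by lia.
  by rewrite intrD mulrDl mulN1r; exact: spanB.
Qed.

Lemma span_tail b s x : span s x -> span (b :: s) x.
Proof. by exists 0%R; rewrite mul0r subr0. Qed.

Lemma span_head b s : span (b :: s) b.
Proof. by exists 1%R; rewrite mul1r subrr; exact: span0. Qed.

Lemma span_mem s x : x \in s -> span s x.
Proof.
elim: s => // b s IH; rewrite inE => /predU1P[->|/IH xs]; first exact: span_head.
exact: span_tail.
Qed.

Lemma span_min s (P : set R) : P 0%R -> (forall x y, P x -> P y -> P (x - y)%R) ->
  (forall x, x \in s -> P x) -> span s `<=` P.
Proof.
move=> P0 PB; have PD x y : P x -> P y -> P (x + y)%R.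
  by move=> Px Py; rewrite -(opprK y) -(sub0r y); do 2!apply: (PB) => //.
elim: s => [_ x ->//|b s IH] Ps x [n /IH nx].
rewrite -(subrK (n%:~R * b)%R x); apply: (PD).
  by apply: nx => y ys; apply: Ps; rewrite inE ys orbT.
have {nx} Pb : P b by apply: Ps; rewrite mem_head.
elim/int_rect: n => [|n IHn|n IHn]; first by rewrite mul0r.
- by rewrite -addn1 PoszD intrD mulrDl mul1r; exact: PD.
- rewrite (_ : (- n.+1%:Z = - n%:Z - 1)%R); last by lia.
  by rewrite intrD mulrDl mulN1r; exact: PB.
Qed.

(** Either no multiple of the first generator lies in the span of the others, and
    its coefficient is a homomorphism; or [m] times the group lies in that span,
    and multiplication by [m] is followed by a homomorphism of the span. *)
Lemma span_int_hom s : has (fun x => x != 0%R) s -> exists psi : R -> int,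
  (forall x y, span s x -> span s y -> psi (x + y)%R = (psi x + psi y)%R) /\
  exists2 x, span s x & psi x != 0%R.
Proof.
elim: s => // b s IH hs.
have [[m m0 sm]|nm] := pselect (exists2 m : int, m != 0%R & span s (m%:~R * b)%R).
  have /IH[psi [psiD [x sx x0]]] : has (fun x => x != 0%R) s.
    apply/negPn/negP => /hasPn s0.
    have sp0 : span s `<=` [set 0%R].
      apply: span_min => //; first by move=> x y -> ->; rewrite subr0.
      by move=> x /s0; rewrite negbK => /eqP.
    move: hs => /= /orP[b0|/hasP[x /s0]]; last by rewrite negbK => /eqP ->; rewrite eqxx.
    by have /eqP := sp0 _ sm; rewrite mulf_eq0 intr_eq0 (negbTE m0) (negbTE b0).
  have sM y : span (b :: s) y -> span s (m%:~R * y)%R.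
    move=> [n sy]; rewrite (_ : (m%:~R * y =
      m%:~R * (y - n%:~R * b) + n%:~R * (m%:~R * b))%R); last by lra.
    by apply: spanD; exact: spanZ.
  exists (fun y => psi (m%:~R * y)%R); split.
    by move=> y z /sM sy /sM sz; rewrite mulrDr psiD.
  exists x; first exact: span_tail.
  have psi0 : psi 0%R = 0%R.
    by have := psiD 0%R 0%R (span0 s) (span0 s); rewrite addr0; lia.
  have psiZ (n : nat) : psi (n%:~R * x)%R = (n%:Z * psi x)%R.
    elim: n => [|n IHn]; first by rewrite mul0r psi0 mul0r.
    by rewrite -addn1 PoszD intrD mulrDl mul1r psiD ?IHn //; [lia|exact: spanZ].
  case: m m0 {sm sM} => n n0; first by rewrite psiZ mulf_neq0.
  have sn := spanZ n.+1 sx; have snN := spanZ (- n.+1%:Z)%R sx.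
  have := psiD _ _ sn snN; rewrite -mulrDl -intrD subrr mul0r psi0 psiZ NegzE.
  by nia.
pose psi y := xget 0%R [set n : int | span s (y - n%:~R * b)%R].
have uniq y n n' : span s (y - n%:~R * b)%R -> span s (y - n'%:~R * b)%R -> n = n'.
  move=> sn sn'; apply/eqP; rewrite -subr_eq0; apply: contrapT => /negP nn.
  apply: nm; exists (n - n')%R => //; have := spanB sn' sn; congr (span s _).
  by rewrite intrD mulrNz; lra.
have psiP y : span (b :: s) y -> span s (y - (psi y)%:~R * b)%R.
  by move=> [n sy]; rewrite /psi; case: xgetP => // /(_ n).
exists psi; split.
  move=> x y sx sy; apply: (uniq (x + y)%R); first by apply: psiP; exact: spanD.
  have := spanD (psiP _ sx) (psiP _ sy); congr (span s _).
  by rewrite intrD; lra.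
exists b; first exact: span_head.
rewrite (uniq b (psi b) 1%R) //; first by apply: psiP; exact: span_head.
by rewrite mul1r subrr; exact: span0.
Qed.

End Span.

Section IntHom.
Context {R : realType} {G : groupType}.

Lemma real_hom_int (D : set G) (beta : G -> R) : subgroup D -> fgen D -> is_hom D beta ->
  (exists2 x, D x & beta x != 0%R) ->
  exists2 phi : G -> int, is_hom D phi & exists2 x, D x & phi x != 0%R.
Proof.
move=> sD [t tD tgen] hb [d Dd d0].
pose s := [seq beta x | x <- t].
have Ds x : D x -> span s (beta x).
  move=> Dx; suff [] : [set x | D x /\ span s (beta x)] x by [].
  apply: tgen Dx => [|y yt]; last by split; [exact: tD|apply: span_mem; exact: map_f].
  split.
  - by split; [exact: sg1|rewrite (hom1 sD hb); exact: span0].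
  - by move=> y z [Dy sy] [Dz sz]; split; [exact: sgM|rewrite hb //; exact: spanD].
  - move=> y [Dy sy]; split; first exact: sgV.
    by rewrite (homV sD hb) // -sub0r; apply: spanB => //; exact: span0.
have hs : has (fun x => x != 0%R) s.
  apply/negPn/negP => /hasPn s0; move: d0; rewrite (_ : beta d = 0%R) ?eqxx //.
  apply: (@span_min _ s [set 0%R]) (Ds _ Dd) => //.
    by move=> x y -> ->; rewrite subr0.
  by move=> x /s0; rewrite negbK => /eqP.
have [psi [psiD [x sx x0]]] := span_int_hom hs.
exists (psi \o beta).
  by move=> y z Dy Dz /=; rewrite hb // psiD //; exact: Ds.
suff [y Dy yx] : exists2 y, D y & beta y = x by exists y => //=; rewrite yx.
apply: (@span_min _ s [set x | exists2 y, D y & beta y = x]) sx.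
- by exists 1; [exact: sg1|rewrite (hom1 sD hb)].
- move=> _ _ [y Dy <-] [z Dz <-]; have DVz := sgV sD Dz.
  by exists (y * z^-1); [exact: sgM|rewrite hb // (homV sD hb)].
- by move=> _ /mapP[y yt ->]; exists y => //; exact: tD.
Qed.

End IntHom.

Section PolySeries.
Context {G : groupType}.

(** The shape of [D] that excludes exponential growth: a series that is normal in
    the whole group, with cyclic quotients on which conjugation acts by signs. The
    list collects the generators of the quotients. *)
Inductive sign_series : seq G -> set G -> Prop :=
| SignNil : sign_series [::] [set 1]
| SignCons t l (C D : set G) : subgroup D -> normal_in [set: G] C -> C `<=` D -> D t ->
    (forall x, D x -> exists k : int, C ((zpow t k)^-1 * x)) ->
    (forall g, C (t^-1 * t ^ g) \/ C (t * t ^ g)) ->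
    sign_series l C -> sign_series (t :: l) D.

Context {R : realType} (r : left_ordering G) (F : {fset G}).
Hypotheses (Fr : lo_base F r) (iso : isolated_by r F).
Context (N : nat -> set G) (chain : solvable_chain N).

(** [D] is finitely generated, so some nonzero homomorphism [phi] to the integers
    exists, and by uniqueness it has the same kernel as the real one. Again by
    uniqueness, conjugation by [g] multiplies [phi] by a number which, like its
    inverse, preserves the image of [phi]; so it is a sign. *)
Lemma isolated_sign_series n (D : set G) : hirsch n D -> convex r [set: G] D ->
  normal_in [set: G] D -> exists l, sign_series l D.
Proof.
elim/ltn_ind: n D => n IH D hD cD nD; have sD := hirsch_subgroup hD.
have [pD|nD1] := pselect (proper D [set 1]); last first.
  exists [::]; suff -> : D = [set 1] by exact: SignNil.
  by apply/seteqP; split=> [x /(properPn nD1)//|x ->]; exact: sg1.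
have [beta uh] := isolated_unique_hom (R := R) Fr iso chain hD cD pD.
have [phi hphi phi0] := real_hom_int sD (hirsch_fgen hD) (uh_hom uh) (uh_nz uh).
have hphiR : is_hom D (fun x => (phi x)%:~R%R : R).
  by move=> x y Dx Dy; rewrite hphi // intrD.
have [c cE] := uh_unique uh hphiR.
have c0 : c != 0%R.
  apply/eqP => c0; have [x Dx /eqP[]] := phi0; apply/eqP.
  by have /eqP := cE x Dx; rewrite c0 mul0r intr_eq0.
pose C := [set x | D x /\ phi x = 0%R].
have CE : C = [set x | D x /\ beta x = 0%R].
  apply/seteqP; split=> x [Dx x0]; split=> //; apply/eqP.
    by have /eqP := cE x Dx; rewrite x0 eq_sym mulf_eq0 (negbTE c0).
  by rewrite -(intr_eq0 R) cE // x0 mulr0.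
have [t [Dt t0 tgen]] := hom_int_gen sD hphi phi0.
have DJ x g : D x -> D (x ^ g) by move=> Dx; exact: nD.
have actR (g : G) : exists d : R, forall x, D x -> ((phi (x ^ g)%g)%:~R = d * (phi x)%:~R)%R.
  have hJ : is_hom D (fun x => (phi (x ^ g)%g)%:~R%R : R).
    by move=> x y Dx Dy; rewrite conjMg hphiR //; exact: DJ.
  have [d dE] := uh_unique uh hJ; exists (d / c)%R => x Dx.
  by rewrite dE // cE // mulrA mulfVK.
have act (g : G) : exists k : int, forall x, D x -> phi (x ^ g)%g = (k * phi x)%R.
  have [d dE] := actR g; have [k kE] := tgen _ (DJ _ g Dt).
  exists k => x Dx; have tR : (phi t)%:~R%R != 0%R :> R by rewrite intr_eq0 gt_eqF.
  have dk : d = (k%:~R)%R.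
    by apply: (mulIf tR); rewrite -dE // kE intrM.
  by apply/eqP; rewrite -(eqr_int R) intrM dE // dk.
have sign (g : G) : (forall x, D x -> phi (x ^ g)%g = phi x) \/
    (forall x, D x -> phi (x ^ g)%g = (- phi x)%R).
  have [k kE] := act g; have [k' k'E] := act g^-1.
  have := kE _ (DJ _ g^-1 Dt); rewrite conjgKV k'E // => e.
  have kk : (k * k' = 1)%R.
    have tz : phi t != 0%R by rewrite gt_eqF.
    by apply: (mulIf tz); rewrite mul1r -mulrA -e.
  have [k1|k1] : k = 1%R \/ k = (-1)%R.
    have /eqP := congr1 absz kk; rewrite abszM muln_eq1 => /andP[/eqP k1 _]; lia.
    by left=> x Dx; rewrite kE // k1 mul1r.
  by right=> x Dx; rewrite kE // k1 mulN1r.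
have cC : convex r [set: G] C by rewrite CE; exact: convex_trans cD (uh_convex uh).
have nC : normal_in [set: G] C.
  move=> g x _ [Dx x0]; split; first exact: DJ.
  by case: (sign g) => -> //; rewrite x0 ?oppr0.
have CD : C `<=` D by move=> x [].
have [m mn hC] : exists2 m, (m < n)%N & hirsch m C.
  have sC : subgroup C by case: cC.
  have [//|[_ fC]] := hirsch_sub hD sC CD.
  have [x Dx /eqP x0] := phi0; case: x0.
  have cDC : convex r D C by split=> // y z Cy _; case: cC => _ _; exact.
  by have [] := convex_fin_index sD cDC fC Dx.
have [l sl] := IH m mn C hC cC nC.
exists (t :: l); apply: (SignCons sD nC CD Dt _ _ sl).
- move=> x Dx; have [k kE] := tgen x Dx; exists k.
  have Dz := sgZ k sD Dt; have DVz := sgV sD Dz.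
  split; first exact: sgM.
  by rewrite hphi // (homV sD hphi) // (homZ sD hphi) // mulrzz kE; lia.
- move=> g; have DVt := sgV sD Dt; have Dg := DJ _ g Dt.
  case: (sign g) => sg; [left|right]; (split; first exact: sgM).
    by rewrite hphi // (homV sD hphi) // sg // addNr.
  by rewrite hphi // sg // subrr.
Qed.

End PolySeries.

(** * Polynomial growth *)

Section Words.
Context {G : groupType}.
Implicit Types (l : seq G) (x y z t g : G).

Inductive word l : nat -> set G :=
| Word1 L : word l L 1
| WordS L y z : y \in l \/ y^-1 \in l -> word l L z -> word l L.+1 (y * z).

Lemma word_le l L M x : (L <= M)%N -> word l L x -> word l M x.
Proof.
move=> + w; elim: w M => [?|{}L y z yl _ IH] [|M] //=; try by move=> _; exact: Word1.
by rewrite ltnS => LM; apply: WordS => //; exact: IH.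
Qed.

Lemma wordM l L M x y : word l L x -> word l M y -> word l (L + M)%N (x * y).
Proof.
move=> wx wy; elim: wx => [K|K u z ul _ IH].
  by rewrite mul1g; apply: word_le wy; rewrite leq_addl.
by rewrite addSn -mulgA; exact: WordS.
Qed.

Lemma word_letter l y : y \in l \/ y^-1 \in l -> word l 1 y.
Proof. by move=> yl; rewrite -(mulg1 y); apply: WordS => //; exact: Word1. Qed.

Lemma wordV l L x : word l L x -> word l L x^-1.
Proof.
elim=> [K|K y z yl _ IH]; first by rewrite invg1; exact: Word1.
rewrite invgM -addn1; apply: wordM => //; apply: word_letter.
by rewrite invgK; case: yl; [right|left].
Qed.

Lemma word_subst l l' L K (f : G -> G) x : {morph f : x y / x * y} -> f 1 = 1 ->
  (forall y, y \in l \/ y^-1 \in l -> word l' K (f y)) ->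
  word l L x -> word l' (L * K)%N (f x).
Proof.
move=> fM f1 fK; elim=> [M|M y z /fK yK _ IH]; first by rewrite f1; exact: Word1.
by rewrite fM mulSn; exact: wordM.
Qed.

Lemma word_sub l l' L x : {subset l <= l'} -> word l L x -> word l' L x.
Proof.
move=> ll; rewrite -{2}(muln1 L); apply: (@word_subst _ _ _ _ id) => // y yl.
by apply: word_letter; case: yl => /ll; [left|right].
Qed.

Lemma word_conj l l' L K g x : (forall y, y \in l \/ y^-1 \in l -> word l' K (y ^ g)) ->
  word l L x -> word l' (L * K)%N (x ^ g).
Proof.
by apply: (@word_subst _ _ _ _ (fun x => x ^ g)); [move=> ? ?; exact: conjMg|exact: conj1g].
Qed.

Lemma word_expn l t n : t \in l \/ t^-1 \in l -> word l n (t ^+ n).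
Proof.
by move=> tl; elim: n => [|n IH]; [exact: Word1|rewrite expgS; exact: WordS].
Qed.

Lemma word_zpow l t k : t \in l -> word l `|k|%N (zpow t k).
Proof.
move=> tl; case: k => n; first by apply: word_expn; left.
by apply: wordV; apply: word_expn; left.
Qed.

Lemma sign_series_word l D x : sign_series l D -> D x -> exists L, word l L x.
Proof.
move=> h; elim: h x => {l D} [x ->|t l C D sD nC CD Dt gen _ _ IH x Dx].
  by exists 0%N; exact: Word1.
have [k /IH[L w]] := gen x Dx; exists (`|k| + L)%N.
rewrite -(mulVKg (zpow t k) x); apply: wordM.
  by apply: word_zpow; rewrite mem_head.
by apply: word_sub w => y yl; rewrite inE yl orbT.
Qed.

(** If [t ^ g] is [t] or its inverse, times [u] in the next term of the series,
    then [t ^ (g ^+ E.+1)] is [t ^ (g ^+ E)] or its inverse, times [u ^ (g ^+ E)].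
    So its length is a sum of [E] lengths that are polynomial in [E] by
    induction. *)
Lemma conj_growth l D : sign_series l D -> forall g, exists d, forall E y,
  y \in l \/ y^-1 \in l -> word l ((E + 2) ^ d)%N (y ^ (g ^+ E)).
Proof.
elim=> {l D} [g|t l C D sD nC CD Dt gen sign sl IH g]; first by exists 0%N => E y [].
have [d dP] := IH g.
have sub : {subset l <= t :: l} by move=> y yl; rewrite inE yl orbT.
have [rho [u [wu tu]]] : exists rho u, word l rho u /\ (t ^ g = t * u \/ t ^ g = t^-1 * u).
  case: (sign g) => Cu; have [L w] := sign_series_word sl Cu.
    by exists L, (t^-1 * t ^ g); split=> //; left; rewrite mulVKg.
  by exists L, (t * t ^ g); split=> //; right; rewrite mulKg.
have pos n k : (0 < (n + 2) ^ k)%N by rewrite expn_gt0 addn2.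
have tE E : word (t :: l) (1 + E * (rho * (E + 2) ^ d))%N (t ^ (g ^+ E)).
  elim: E => [|E IHE].
    by rewrite conjg1; apply: word_letter; left; rewrite mem_head.
  have wuE : word (t :: l) (rho * (E + 2) ^ d)%N (u ^ (g ^+ E)).
    by apply: word_sub sub _; apply: word_conj wu => y; exact: dP.
  apply: (@word_le _ (1 + E * (rho * (E + 2) ^ d) + rho * (E + 2) ^ d)%N).
    rewrite -addnA leq_add2l -mulSnr leq_mul2l /= leq_mul2l.
    by apply/orP; right; case: d {dP pos IHE wuE} => // d; rewrite leq_exp2r // leq_add2r.
  rewrite expgS conjgM; case: tu => ->; rewrite conjMg; apply: wordM => //.
  by rewrite conjVg; exact: wordV.
exists (1 + rho + d)%N => E y.
have b1 : ((E + 2) ^ d <= (E + 2) ^ (1 + rho + d))%N.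
  by rewrite leq_pexp2l ?addn2 // leq_addl.
have b2 : (1 + E * (rho * (E + 2) ^ d) <= (E + 2) ^ (1 + rho + d))%N.
  rewrite !expnD expn1; set X := ((E + 2) ^ d)%N; set Y := ((E + 2) ^ rho)%N.
  have X0 : (0 < X)%N := pos _ _.
  have Yr : (rho < Y)%N.
    apply: leq_trans (ltn_expl rho (ltnSn 1)) _.
    by rewrite /Y; case: (rho) => // n; rewrite leq_exp2r // leq_addl.
  have : (rho.+1 * X <= Y * X)%N by rewrite leq_mul2r Yr orbT.
  nia.
have wt := word_le b2 (tE E).
case; rewrite inE => /predU1P[].
- by move=> ->.
- by move=> yl; apply: word_sub sub _; apply: word_le b1 _; apply: dP; left.
- by move=> yt; rewrite -(invgK y) yt conjVg; exact: wordV.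
- by move=> yl; apply: word_sub sub _; apply: word_le b1 _; apply: dP; right.
Qed.

(** The letters [t] are moved to the left. Each of the other letters is then
    conjugated by a power of [t] with exponent at most [L], which costs a
    polynomial factor. *)
Lemma word_normal_form t l C : sign_series l C ->
  exists d, forall M L x, (L <= M)%N -> word (t :: l) L x -> exists (e : int) (q : G),
    [/\ (`|e| <= L)%N, x = zpow t e * q & word l (L * (M + 2) ^ d)%N q].
Proof.
move=> sl; have [d1 d1P] := conj_growth sl t; have [d2 d2P] := conj_growth sl t^-1.
exists (maxn d1 d2) => M L x + w; elim: w => {L x} [L _|L y z yl _ IH LM].
  by exists 0%R, 1; split; rewrite ?zpow0 ?mulg1 //; exact: Word1.
have [e [q [eL -> wq]]] := IH (ltnW LM).
have [[s [s1 ->]]|yl'] : (exists s : int, (`|s| = 1)%N /\ y = zpow t s) \/ (y \in l \/ y^-1 \in l).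
  case: yl; rewrite inE => /predU1P[].
  - by move=> ->; left; exists 1%R; rewrite zpow1.
  - by right; left.
  - by move=> yt; left; exists (-1)%R; rewrite zpowN1 -(invgK y) yt.
  - by right; right.
  exists (s + e)%R, q; split; [by lia|by rewrite zpowD mulgA|].
  by apply: word_le wq; rewrite leq_mul2r leqnSn orbT.
exists e, (y ^ zpow t e * q); split; first exact: leq_trans eL (leqnSn L).
  by rewrite mulgA [y * zpow t e]conjgC -mulgA.
rewrite mulSn; apply: wordM => //.
have eM : (`|e| + 2 <= M + 2)%N by rewrite leq_add2r; apply: leq_trans eL (ltnW LM).
have le k d : (k <= maxn d1 d2)%N -> (d <= M)%N -> ((d + 2) ^ k <= (M + 2) ^ maxn d1 d2)%N.
  move=> kd dM; apply: (@leq_trans ((M + 2) ^ k)%N).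
    by case: k {kd} => // k; rewrite leq_exp2r // leq_add2r.
  by rewrite leq_pexp2l ?addn2.
have eM' : (`|e| <= M)%N by rewrite -(leq_add2r 2).
case: e eM' {eL eM} => n nM.
  apply: word_le (d1P n y yl'); apply: le => //; exact: leq_maxl.
rewrite -[zpow _ _]expVgn; apply: word_le (d2P n.+1 y yl').
apply: le => //; exact: leq_maxr.
Qed.

Lemma sign_series_growth l D : sign_series l D -> exists d, forall L, exists s : seq G,
  (size s <= (L + 2) ^ d)%N /\ forall x, word l L x -> x \in s.
Proof.
elim=> {l D} [|t l C D sD nC CD Dt gen sign sl [d dP]].
  exists 0%N => L; exists [:: 1]; split=> // x; case=> [?|? y z []] //.
  by rewrite mem_head.
have [d1 nf] := word_normal_form t sl.
exists (2 + (d1 + 2) * d)%N => L.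
have [s [sz sP]] := dP (L * (L + 2) ^ d1)%N.
exists [seq zpow t e * q | e <- [seq (Posz i - Posz L)%R | i <- iota 0 (2 * L + 1)], q <- s].
split.
  rewrite size_allpairs size_map size_iota expnD; apply: leq_mul; first by rewrite expnS expn1; nia.
  apply: leq_trans sz _; rewrite expnM; case: (d) => // k; rewrite leq_exp2r //.
  have X0 : (0 < (L + 2) ^ d1)%N by rewrite expn_gt0 addn2.
  rewrite expnD; move: X0; set X := ((L + 2) ^ d1)%N; rewrite expnS expn1; nia.
move=> x /(nf L L x (leqnn L)) [e [q [eL -> wq]]].
apply/allpairsP; exists (e, q); split=> //=; last exact: sP.
by apply/mapP; exists (`|(e + L)%R|%N); [rewrite mem_iota|]; lia.
Qed.

End Words.

Section Exponential.
Context {R : realType}.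

(** With [n = m * d.+1], Bernoulli's inequality for [c ^+ m] makes [c ^+ n] grow
    at least like the power [d.+1] of [m]. *)
Lemma exp_beats_poly (c : R) (K d : nat) : (1 < c)%R ->
  exists n, (((K * (n + 2)) ^ d)%N%:R < c ^+ n)%R.
Proof.
move=> c1; pose h := (c - 1)%R; have h0 : (0 < h)%R by rewrite subr_gt0.
pose h' := Num.min 1%R h; have h'0 : (0 < h')%R by rewrite lt_min h0 ltr01.
pose K' := (K * (d + 3))%N.
pose m := Num.bound (K'%:R ^+ d / h' ^+ d.+1)%R.
have mP : (K'%:R ^+ d / h' ^+ d.+1 < m.+1%:R)%R.
  apply: lt_trans (archi_boundP _) _; last by rewrite ltr_nat.
  by rewrite divr_ge0 ?exprn_ge0 // ltW.
exists (m * d.+1)%N.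
have step1 : ((h' * m.+1%:R) ^+ d.+1 <= c ^+ (m * d.+1))%R.
  rewrite exprM lerXn2r ?nnegrE ?mulr_ge0 ?exprn_ge0 ?(ltW h'0) //; first by lra.
  have := bernoulli m (ltW h0); rewrite (_ : 1 + h = c)%R; last by rewrite /h; lra.
  apply: le_trans; rewrite -natr1 mulrDr mulr1 addrC lerD ?ge_min ?lexx //.
  by rewrite mulrC ler_wpM2l // ge_min lexx orbT.
apply: lt_le_trans step1.
have step2 : ((K * (m * d.+1 + 2)) ^ d <= (K' * m.+1) ^ d)%N.
  case: d @K' @m mP => // d K' m mP; rewrite leq_exp2r // /K' -mulnA leq_mul2l.
  by apply/orP; right; nia.
apply: (@le_lt_trans _ _ (((K' * m.+1) ^ d)%N%:R)%R); first by rewrite ler_nat.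
have M0 : (0 < m.+1%:R ^+ d :> R)%R by rewrite exprn_gt0 ?ltr0Sn.
rewrite natrX natrM exprMn [ltRHS]exprMn [(m.+1%:R ^+ d.+1)%R]exprS mulrA ltr_pM2r //.
by move: mP; rewrite ltr_pdivrMr ?exprn_gt0 // mulrC.
Qed.

Lemma sign_series_not_exponential (G : groupType) (l : seq G) :
  sign_series l [set: G] -> ~ exponential_growth R G.
Proof.
move=> sl [S _ [c c1 growth]].
have [d dP] := sign_series_growth sl.
have [K KP] : exists K, forall y, y \in S \/ y^-1 \in S -> word l K y.
  suff [K KP] : exists K, forall y, y \in (S : seq G) -> word l K y.
    exists K => y [/KP//|/KP/wordV]; by rewrite invgK.
  elim: (S : seq G) => [|y s [K KP]]; first by exists 0%N.
  have [L wL] := sign_series_word sl (x := y) I.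
  exists (K + L)%N => z; rewrite inE => /predU1P[->|/KP wz].
    by apply: word_le wL; rewrite leq_addl.
  by apply: word_le wz; rewrite leq_addr.
have [n] := exp_beats_poly (K + 1) d c1; rewrite ltNge => /negP; apply.
apply: le_trans (growth n) _; rewrite ler_nat.
have [s [sz sP]] := dP (n * K)%N.
apply: (@leq_trans (size s)); last first.
  apply: leq_trans sz _; case: (d) => // k; rewrite leq_exp2r //; nia.
apply: uniq_leq_size; first exact: fset_uniq.
move=> x; rewrite in_fset_set; last exact: word_ball_finite.
rewrite inE => -[w [sw wl] <-]; apply: sP.
apply: (@word_le _ _ (size w * K)%N); first by rewrite leq_mul2r sw orbT.
elim: w wl {sw} => [|y w IH] wl; first by rewrite big_nil; exact: Word1.
rewrite big_cons mulSn; apply: wordM.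
  by apply: KP; apply: wl; rewrite mem_head.
by apply: IH => z zw; apply: wl; rewrite inE zw orbT.
Qed.

End Exponential.

(** * The space of left-orderings *)

Section OrderSpace.
Context {G : groupType}.
Local Notation LO := (left_ordering G).

Lemma lo_base_open (F : {fset G}) : open (lo_base F).
Proof. by exists [set F] => //; rewrite bigcup_set1. Qed.

Lemma lo_nbhs_base (s : LO) (U : set LO) : nbhs s U ->
  exists2 F : {fset G}, lo_base F s & lo_base F `<=` U.
Proof.
rewrite nbhsE => -[V [[D _ DV] Vs VU]].
move: Vs; rewrite -DV => -[F DF Fs]; exists F => //.
by apply: subset_trans VU; rewrite -DV => t Ft; exists F.
Qed.

Lemma open_isolated (r : LO) : open [set r] ->
  exists2 F : {fset G}, lo_base F r & isolated_by r F.
Proof.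
move=> op; have [|F Fr FU] := @lo_nbhs_base r [set r]; first exact: open_nbhs_nbhs.
by exists F => // s /FU.
Qed.

(** A nontrivial [x] is not positive exactly when its inverse is. *)
Lemma open_pos (x : G) (b : bool) : open [set s : LO | s 1 x = b].
Proof.
case: b.
  rewrite (_ : [set s : LO | _] = lo_base [fset x]%fset); first exact: lo_base_open.
  apply/seteqP; split=> s /=; first by move=> sx f; rewrite inE => /eqP ->.
  by apply; rewrite inE.
have [->|x1] := eqVneq x 1.
  rewrite (_ : [set s : LO | _] = set0); first exact: open0.
  by apply/seteqP; split=> // s /=; rewrite lo_refl.
rewrite (_ : [set s : LO | _] = lo_base [fset x^-1]%fset); first exact: lo_base_open.
apply/seteqP; split=> s /=.
  by move=> sx f; rewrite inE => /eqP ->; case: (lo_tot s x) => //; rewrite sx.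
move=> /(_ x^-1); rewrite inE eqxx => /(_ isT) sV.
by apply/negbTE/negP => sx; move: x1; rewrite (lo_anti1 sx sV) eqxx.
Qed.

(** The relations that hold for almost all orders, along an ultrafilter, form an
    order, which is the limit of the ultrafilter. *)
Lemma lo_compact : compact [set: LO].
Proof.
rewrite compact_ultra => U UU _.
pose le x y := `[< U [set s : LO | s x y] >].
have le_total : total le.
  move=> x y; apply/orP; have [h|h] := in_ultra_setVsetC [set s : LO | s x y] UU.
    by left; apply/asboolP.
  right; apply/asboolP; apply: filterS h => s /= /negP sxy.
  by have /orP[|//] := lo_total s x y; rewrite (negbTE sxy).
have le_anti : antisymmetric le.
  move=> x y /andP[/asboolP xy /asboolP yx].
  have [s [/= sxy syx]] := filter_ex (filterI xy yx).
  by apply: (@lo_anti _ s); rewrite sxy syx.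
have le_trans : transitive le.
  move=> y x z /asboolP xy /asboolP yz; apply/asboolP.
  by apply: filterS (filterI xy yz) => s [/= sxy syz]; exact: lo_trans sxy syz.
have le_mul f g h : le f g -> le (h * f) (h * g).
  by move=> /asboolP fg; apply/asboolP; apply: filterS fg => s /=; exact: lo_mul2l.
exists (LeftOrdering le_total le_anti le_trans le_mul); split=> // V /lo_nbhs_base[F Fs FV].
apply: filterS FV _.
have {}Fs f : f \in (F : seq G) -> U [set s : LO | s 1 f] by move=> /Fs /asboolP.
rewrite (_ : lo_base F = [set s : LO | forall f, f \in (F : seq G) -> s 1 f]) //.
elim: (F : seq G) Fs => [|f l IH] Fs; first by apply: filterS filterT => s _ f.
have Uf := Fs f (mem_head _ _).
have Ul : U [set s : LO | forall f, f \in l -> s 1 f].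
  by apply: IH => h hl; apply: Fs; rewrite inE hl orbT.
by apply: filterS (filterI Uf Ul) => s [sf sl] h; rewrite inE => /predU1P[->//|/sl].
Qed.

(** The base point serves the characterization of the Cantor space, which is
    about pointed spaces. *)
Definition pointed_orders (r0 : LO) : Type := LO.
HB.instance Definition _ (r0 : LO) := Choice.on (pointed_orders r0).
HB.instance Definition _ (r0 : LO) := isPointed.Build (pointed_orders r0) r0.

Section Coded.
Context {R : realType} (e : nat -> G) (eP : forall x, exists n, e n = x) (r0 : LO).

(** The signs of the elements of a countable group. The topology that this map
    induces is metrizable, and it is the topology of the space of orders. *)
Definition code (s : pointed_orders r0) : tree_of (fun=> bool) := fun n => (s : LO) 1 (e n).

Local Notation X := (initial_topology code).

Lemma code_continuous : continuous (code : LO -> tree_of (fun=> bool)).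
Proof.
move=> s; apply/cvg_sup; first exact/fmap_filter/nbhs_filter.
move=> n; move: s; apply/(@continuousP _ (initial_topology (@^~ n))) => A [B _ <-].
rewrite openE => s Bs; apply: (@filterS _ _ _ [set t : LO | t 1 (e n) = s 1 (e n)]).
  by move=> t /= ts; move: Bs; rewrite /= /code ts.
by apply: open_nbhs_nbhs; split=> //; exact: open_pos.
Qed.

Lemma coded_id_continuous : continuous (id : LO -> X).
Proof. by apply: continuous_comp_initial; exact: code_continuous. Qed.

Lemma coded_nbhs (s : X) (x : G) : (s : LO) 1 x -> nbhs s [set t : X | (t : LO) 1 x].
Proof.
have [n <-] := eP x => sn.
apply: (@filterS _ _ _ (code @^-1` (proj n @^-1` [set true]))); first by [].
apply: open_nbhs_nbhs; split=> //.
exists (proj n @^-1` [set true]) => //.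
by apply: open_comp; [move=> + _; exact: proj_continuous|exact: discrete_open].
Qed.

Lemma id_coded_continuous : continuous (id : X -> LO).
Proof.
move=> s V /lo_nbhs_base [F Fs FV].
have {}Fs f : f \in (F : seq G) -> nbhs (s : X) [set t : X | (t : LO) 1 f].
  by move=> /Fs; exact: coded_nbhs.
suff : nbhs (s : X) [set t : X | forall f, f \in (F : seq G) -> (t : LO) 1 f].
  by apply: (@filterS X (nbhs (s : X)) _) => t /FV.
elim: (F : seq G) Fs => [|f l IH] Fs.
  by apply: (@filterS X (nbhs (s : X)) _) filterT => t _ f.
have Uf := Fs f (mem_head _ _).
have Ul : nbhs (s : X) [set t : X | forall f, f \in l -> (t : LO) 1 f].
  by apply: IH => h hl; apply: Fs; rewrite inE hl orbT.
apply: (@filterS X (nbhs (s : X)) _) (filterI Uf Ul) => t [tf tl] h.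
by rewrite inE => /predU1P[->//|/tl].
Qed.

Hypothesis perfectLO : forall r : LO, ~ open [set r].

Lemma coded_cantor_like : cantor_like X.
Proof.
have zX : zero_dimensional X.
  move=> x y xy.
  have zT : zero_dimensional (tree_of (fun=> bool)).
    by apply: zero_dimension_prod => _; exact: discrete_zero_dimension.
  have cxy : code x != code y.
    apply: contra_neq xy => cxy; apply: left_ordering_eq => f g.
    rewrite [LHS]lo_div [RHS]lo_div; have [n <-] := eP (f^-1 * g).
    exact: (congr1 (fun h => h n) cxy).
  have [U [cU Ux Uy]] := zT _ _ cxy.
  exists (code @^-1` U); split=> //; apply: preimage_clopen => //.
  exact: initial_continuous.
split=> //.
- apply/perfectTP => r rop; apply: (@perfectLO r).
  by have /continuousP/(_ _ rop) := coded_id_continuous.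
- rewrite (_ : [set: X] = (id : LO -> X) @` [set: LO]); last by rewrite image_id.
  apply: continuous_compact; last exact: lo_compact.
  by apply: continuous_subspaceT; exact: coded_id_continuous.
- rewrite open_hausdorff => x y /zX[U [[oU cU] Ux Uy]].
  exists (U, ~` U); first by rewrite !inE.
  by split=> //=; [exact: closed_openC|rewrite setICr].
Qed.

Definition coded : Type := X.
HB.instance Definition _ := Pointed.on coded.
HB.instance Definition _ := Uniform.on coded.
HB.instance Definition _ : @PseudoMetric R _ := @PseudoMetric.on coded.

Lemma order_space_homeomorphic : homeomorphic LO cantor_space.
Proof.
have [f [fc fclosed]] := @homeomorphism_cantor_like R coded coded_cantor_like.
have fK : cancel f f^-1%FUN by move=> x; rewrite funK // inE.
have fVK : cancel f^-1%FUN f by move=> x; rewrite invK // inE.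
exists (f^-1%FUN : LO -> cantor_space), (f : cantor_space -> LO); split=> //.
  have cV : continuous (f^-1%FUN : X -> cantor_space).
    apply/continuous_closedP => A /fclosed; congr closed.
    apply/seteqP; split=> [_ [a Aa <-]|x Ax] /=; first by rewrite fK.
    by exists (f^-1%FUN x).
  by move=> s; apply: (@continuous_comp LO X _ id); [exact: coded_id_continuous|exact: cV].
by move=> x; apply: (@continuous_comp _ X LO f id); [exact: fc|exact: id_coded_continuous].
Qed.
End Coded.

End OrderSpace.

Lemma generated_enum (G : groupType) (S : {fset G}) : generated [set` S] = [set: G] ->
  exists e : nat -> G, forall x, exists n, e n = x.
Proof.
move=> genS; pose T := (S : seq G) ++ [seq x^-1 | x <- (S : seq G)].
pose eval (w : seq nat) : G := \prod_(i <- w) nth 1 T i.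
pose decode k : seq nat := odflt [::] (choice.unpickle k).
have decodeK w : decode (choice.pickle w) = w by rewrite /decode choice.pickleK.
exists (eval \o decode) => x.
suff [w <-] : exists w, eval w = x by exists (choice.pickle w); rewrite /comp decodeK.
have [L wx] : exists L, word (S : seq G) L x.
  have : [set: G] x by [].
  rewrite -genS; apply: (@generated_min _ _ [set x | exists L, word (S : seq G) L x]); last first.
    by move=> y yS; exists 1%N; apply: word_letter; left.
  split=> [|y z [L wy] [M wz]|y [L wy]].
  - by exists 0%N; exact: Word1.
  - by exists (L + M)%N; exact: wordM.
  - by exists L; exact: wordV.
elim: wx => {L x} [_|_ y z yS _ [w <-]]; first by exists [::]; rewrite /eval big_nil.
have yT : y \in T.
  rewrite mem_cat; case: yS => [->//|yS]; apply/orP; right.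
  by apply/mapP; exists y^-1; rewrite ?invgK.
by exists (index y T :: w); rewrite /eval big_cons nth_index.
Qed.

Theorem corollary1p3 (R : realType) (Gamma : groupType)
  (lo_Gamma : left_orderable Gamma)
  (vp_Gamma : virtually_polycyclic Gamma)
  (exp_Gamma : exponential_growth R Gamma) :
  homeomorphic (left_ordering Gamma) cantor_space.
Proof.
have [r0 _] := lo_Gamma; have [S genS _] := exp_Gamma.
have [e eP] := generated_enum genS.
apply: (order_space_homeomorphic (R := R) eP r0) => r /open_isolated[F Fr iso].
have [N chain] := virtually_polycyclic_chain vp_Gamma.
have [n hn] := virtually_polycyclic_hirsch vp_Gamma.
have cT : convex r [set: Gamma] [set: Gamma] by exact: convex_refl subgroup_setT.
have [//|l sl] := isolated_sign_series (R := R) Fr iso chain hn cT.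
exact: sign_series_not_exponential sl exp_Gamma.
Qed.
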